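(* Let $F$ be a finite field with $|F|=q$ and $\operatorname{char}F=p>2$, and let $G_{\infty}$ be the infinite-dimensional unitary Grassmann algebra $G$ over $F$ with the $\mathbb{Z}_2$-grading induced by the automorphism $\phi_\infty$ given by $e_i\mapsto e_i$ if $i$ is even and $e_i\mapsto -e_i$ if $i$ is odd. Then $T_2(G_{\infty})=I_2$, where $I_2$ is the $T_2$-ideal of $F\langle X\rangle$ generated by the polynomials $$[x_1,x_2,x_3],\qquad z_1^{p},\qquad y_1^{pq}-y_1^{p}.$$
   Context: $G$ is the unitary Grassmann algebra over $F$ generated by $e_1,e_2,\ldots$ subject to $e_ie_j=-e_je_i$ for all $i,j$; it has $F$-basis consisting of $1$ and the products $e_{i_1}\cdots e_{i_n}$ with $i_1<\cdots<i_n$. An automorphism $\phi$ of $G$ of order two induces the $\mathbb{Z}_2$-grading $G=G_0\oplus G_1$ with $G_0=\{2^{-1}(a+\phi(a)) : a\in G\}$ (even component) and $G_1=\{2^{-1}(a-\phi(a)) : a\in G\}$ (odd component). $F\langle X\rangle$ is the free unitary associative algebra on $X=Y\cup Z$, $Y=\{y_1,y_2,\ldots\}$, $Z=\{z_1,z_2,\ldots\}$ (disjoint countable sets), $\mathbb{Z}_2$-graded by giving each $y_i$ degree $0$ and each $z_i$ degree $1$. The letters $x_1,x_2,x_3$ stand for arbitrary variables of $X$ (so $[x_1,x_2,x_3]$ denotes all the polynomials obtained by letting each $x_i$ be an element of $Y$ or of $Z$). For a $\mathbb{Z}_2$-graded algebra $A=A_0\oplus A_1$, $T_2(A)$ is the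 set of $\mathbb{Z}_2$-graded polynomial identities of $A$: the polynomials in $F\langle X\rangle$ that vanish under all substitutions of elements of $A_0$ for the $y$'s and of $A_1$ for the $z$'s. A $T_2$-ideal is a (two-sided) ideal of $F\langle X\rangle$ stable under all endomorphisms $\phi$ of $F\langle X\rangle$ with $\phi(F\langle X\rangle_i)\subset F\langle X\rangle_i$, $i=0,1$; the $T_2$-ideal generated by a set $S$ is the intersection of all $T_2$-ideals containing $S$. $[a,b]=ab-ba$ and $[a,b,c]=[[a,b],c]$. *)

(* Defs.v *)
From HB Require Import structures.
From mathcomp Require Import all_boot all_order all_algebra.
From mathcomp Require Import finmap.
From mathcomp.classical Require Import classical_sets.
From mathcomp.multinomials Require Import monalg.

Set Implicit Arguments.
Unset Strict Implicit.
Unset Printing Implicit Defensive.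

Import GRing.Theory.
Local Open Scope fset_scope.
Local Open Scope ring_scope.

(* The Grassmann algebra is realised on its monomial basis: a finite set      *)
(* S = {i_1 < ... < i_n} of naturals indexes the product e_{i_1} ... e_{i_n}. *)
(* Indices are shifted by one throughout: [grassmann_gen F i], [yvar F i] and *)
(* [zvar F i] are e_{i+1}, y_{i+1} and z_{i+1}.                               *)
Definition grassmann (F : fieldType) : Type := {malg F[{fset nat}]}.

HB.instance Definition _ (F : fieldType) :=
  GRing.Lmodule.copy (grassmann F) {malg F[{fset nat}]}.

Lemma perm_fsetU (K : choiceType) (S T : {fset K}) :
  [disjoint S & T]%fset -> perm_eq (S `|` T) (S ++ T).
Proof.
move=> dST; apply: uniq_perm; first exact: fset_uniq.
  rewrite cat_uniq !fset_uniq andbT /=; apply/hasPn => x xT.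
  by apply/negP => xS; move/fdisjointP: dST => /(_ x xS); rewrite xT.
by move=> x; rewrite mem_cat in_fsetE.
Qed.

(* e_S e_T = 0 when S and T meet, and otherwise sorting the product costs     *)
(* one sign for each pair s \in S, t \in T with t < s.                        *)
Definition ninv (S T : {fset nat}) : nat :=
  (\sum_(s <- S) \sum_(t <- T) (t < s))%N.

Definition gsign (F : fieldType) (S T : {fset nat}) : F :=
  if [disjoint S & T]%fset then (-1) ^+ ninv S T else 0.

Definition grassmann_one (F : fieldType) : grassmann F := << fset0 >>.

HB.lock Definition grassmann_mul (F : fieldType) (g1 g2 : grassmann F) :
  grassmann F :=
  \sum_(S <- msupp g1) \sum_(T <- msupp g2)
    << g1@_S * g2@_T * gsign F S T *g S `|` T >>.
Canonical grassmann_mul_unlockable := Unlockable grassmann_mul.unlock.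

Definition grassmann_gen (F : fieldType) (i : nat) : grassmann F :=
  << [fset i] >>.

Section GrassmannRing.
Context {F : fieldType}.
Implicit Types (S T U : {fset nat}) (g : grassmann F).

Local Notation gsign := (gsign F).
Local Notation grassmann_mul := (@grassmann_mul F).
Local Notation grassmann_one := (grassmann_one F).

Lemma ninvUl S T U : [disjoint S & T]%fset ->
  ninv (S `|` T) U = (ninv S U + ninv T U)%N.
Proof. by move=> dST; rewrite /ninv (perm_big _ (perm_fsetU dST)) big_cat. Qed.

Lemma ninvUr S T U : [disjoint T & U]%fset ->
  ninv S (T `|` U) = (ninv S T + ninv S U)%N.
Proof.
move=> dTU; rewrite /ninv -big_split; apply: eq_bigr => s _ /=.
by rewrite (perm_big _ (perm_fsetU dTU)) big_cat.
Qed.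

Lemma gsign0l S : gsign fset0 S = 1.
Proof. by rewrite /gsign fdisjoint0X /ninv big_seq_fset0. Qed.

Lemma gsign0r S : gsign S fset0 = 1.
Proof.
by rewrite /gsign fdisjointX0 /ninv big1 // => s _; rewrite big_seq_fset0.
Qed.

Lemma gsignA S T U :
  gsign S T * gsign (S `|` T) U = gsign T U * gsign S (T `|` U).
Proof.
rewrite /gsign fdisjointUX fdisjointXU.
have [dST|_] := boolP [disjoint S & T]%fset; last by rewrite mul0r mulr0.
have [dTU|_] := boolP [disjoint T & U]%fset; last by rewrite andbF mul0r mulr0.
rewrite andbT; case: ifP => _; last by rewrite !mulr0.
by rewrite ninvUl // ninvUr // -!exprD; congr (_ ^+ _); rewrite [RHS]addnC addnA.
Qed.

Lemma grassmann_mulEw (d1 d2 : {fset {fset nat}}) g1 g2 :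
  msupp g1 `<=` d1 -> msupp g2 `<=` d2 ->
  grassmann_mul g1 g2 = \sum_(S <- d1) \sum_(T <- d2)
    << g1@_S * g2@_T * gsign S T *g S `|` T >>.
Proof.
move=> le1 le2; rewrite unlock (big_fset_incl _ le1) /=.
  apply/eq_bigr => S _; apply/big_fset_incl => // T _ /mcoeff_outdom ->.
  by rewrite mulr0 mul0r monalgU0.
move=> S _ /mcoeff_outdom g1S.
by rewrite big1 // => T _; rewrite g1S !mul0r monalgU0.
Qed.

Lemma grassmann_mulUU (c1 c2 : F) S T :
  grassmann_mul << c1 *g S >> << c2 *g T >>
  = << c1 * c2 * gsign S T *g S `|` T >>.
Proof.
by rewrite (grassmann_mulEw msuppU_le msuppU_le) !big_seq_fset1 !mcoeffUU.
Qed.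

Lemma grassmann_mulDl : left_distributive grassmann_mul +%R.
Proof.
move=> g1 g2 g; pose d1 := msupp g1 `|` msupp g2; pose d2 := msupp g.
rewrite [LHS](@grassmann_mulEw d1 d2) ?fsubset_refl ?msuppD_le //.
rewrite [grassmann_mul g1 g](@grassmann_mulEw d1 d2) ?fsubset_refl ?fsubsetUl //.
rewrite [grassmann_mul g2 g](@grassmann_mulEw d1 d2) ?fsubset_refl ?fsubsetUr //.
rewrite -big_split /=; apply/eq_bigr => S _.
rewrite -big_split /=; apply/eq_bigr => T _.
by rewrite [(g1 + g2)@_S]mcoeffD !mulrDl monalgUD.
Qed.

Lemma grassmann_mulDr : right_distributive grassmann_mul +%R.
Proof.
move=> g g1 g2; pose d1 := msupp g; pose d2 := msupp g1 `|` msupp g2.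
rewrite [LHS](@grassmann_mulEw d1 d2) ?fsubset_refl ?msuppD_le //.
rewrite [grassmann_mul g g1](@grassmann_mulEw d1 d2) ?fsubset_refl ?fsubsetUl //.
rewrite [grassmann_mul g g2](@grassmann_mulEw d1 d2) ?fsubset_refl ?fsubsetUr //.
rewrite -big_split /=; apply/eq_bigr => S _.
rewrite -big_split /=; apply/eq_bigr => T _.
by rewrite [(g1 + g2)@_T]mcoeffD mulrDr mulrDl monalgUD.
Qed.

Lemma grassmann_mul0g : left_zero 0 grassmann_mul.
Proof. by move=> g; rewrite unlock msupp0 big_seq_fset0. Qed.

Lemma grassmann_mulg0 : right_zero 0 grassmann_mul.
Proof.
by move=> g; rewrite unlock big1 // => S _; rewrite msupp0 big_seq_fset0.
Qed.

Lemma grassmann_mul_suml (I : Type) (r : seq I) (f : I -> grassmann F) g :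
  grassmann_mul (\sum_(i <- r) f i) g = \sum_(i <- r) grassmann_mul (f i) g.
Proof.
exact: (big_morph (grassmann_mul^~ g)
          (fun _ _ => grassmann_mulDl _ _ _) (grassmann_mul0g _)).
Qed.

Lemma grassmann_mul_sumr (I : Type) (r : seq I) (f : I -> grassmann F) g :
  grassmann_mul g (\sum_(i <- r) f i) = \sum_(i <- r) grassmann_mul g (f i).
Proof.
exact: (big_morph (grassmann_mul g)
          (fun _ _ => grassmann_mulDr _ _ _) (grassmann_mulg0 _)).
Qed.

Lemma grassmann_mul1g : left_id grassmann_one grassmann_mul.
Proof.
move=> g; rewrite {1}[g]monalgE grassmann_mul_sumr [RHS]monalgE.
apply: eq_bigr => S _.
by rewrite grassmann_mulUU gsign0l mul1r mulr1 fset0U.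
Qed.

Lemma grassmann_mulg1 : right_id grassmann_one grassmann_mul.
Proof.
move=> g; rewrite {1}[g]monalgE grassmann_mul_suml [RHS]monalgE.
apply: eq_bigr => S _.
by rewrite grassmann_mulUU gsign0r !mulr1 fsetU0.
Qed.

Lemma grassmann_mulA : associative grassmann_mul.
Proof.
move=> g1 g2 g3.
rewrite [g1]monalgE !grassmann_mul_suml; apply: eq_bigr => S _.
rewrite [g2]monalgE grassmann_mul_suml !grassmann_mul_sumr grassmann_mul_suml.
apply: eq_bigr => T _.
rewrite [g3]monalgE !grassmann_mul_sumr; apply: eq_bigr => U _.
rewrite !grassmann_mulUU fsetUA; congr << _ *g _ >>.
set a := g1@_S; set b := g2@_T; set c := g3@_U.
transitivity (a * b * c * (gsign T U * gsign S (T `|` U))).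
  by rewrite !mulrA.
by rewrite -gsignA mulrA [a * b * _ * c]mulrAC.
Qed.

Lemma grassmann_one_neq0 : grassmann_one != 0.
Proof.
by apply/eqP/malgP => /(_ fset0) /eqP; rewrite mcoeffUU mcoeff0 oner_eq0.
Qed.

End GrassmannRing.

HB.instance Definition _ (F : fieldType) :=
  GRing.Zmodule_isNzRing.Build (grassmann F)
    (@grassmann_mulA F) (@grassmann_mul1g F) (@grassmann_mulg1 F)
    (@grassmann_mulDl F) (@grassmann_mulDr F) (@grassmann_one_neq0 F).

Section GrassmannAlgebra.
Context {F : fieldType}.
Implicit Types (S T U : {fset nat}) (g : grassmann F).

Lemma grassmann_scaleU (c d : F) S :
  c *: (<< d *g S >> : grassmann F) = << c * d *g S >>.
Proof. by apply/malgP => T; rewrite mcoeffZ !mcoeffU mulrnAr. Qed.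

Lemma grassmann_mulU (c1 c2 : F) S T :
  (<< c1 *g S >> : grassmann F) * << c2 *g T >>
  = << c1 * c2 * gsign F S T *g S `|` T >>.
Proof. exact: grassmann_mulUU. Qed.

Lemma grassmann_scaleAl (c : F) g1 g2 : c *: (g1 * g2) = (c *: g1) * g2.
Proof.
rewrite [g1]monalgE [in RHS]scaler_sumr !mulr_suml scaler_sumr.
apply: eq_bigr => S _; rewrite [g2]monalgE !mulr_sumr scaler_sumr.
apply: eq_bigr => T _.
by rewrite grassmann_scaleU !grassmann_mulU grassmann_scaleU !mulrA.
Qed.

Lemma grassmann_scaleAr (c : F) g1 g2 : c *: (g1 * g2) = g1 * (c *: g2).
Proof.
rewrite [g2]monalgE [in RHS]scaler_sumr !mulr_sumr scaler_sumr.
apply: eq_bigr => T _; rewrite [g1]monalgE !mulr_suml scaler_sumr.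
apply: eq_bigr => S _.
rewrite grassmann_scaleU !grassmann_mulU grassmann_scaleU !mulrA.
by rewrite [c * _]mulrC.
Qed.

End GrassmannAlgebra.

HB.instance Definition _ (F : fieldType) :=
  GRing.Lmodule_isLalgebra.Build F (grassmann F) (@grassmann_scaleAl F).
HB.instance Definition _ (F : fieldType) :=
  GRing.Lalgebra_isAlgebra.Build F (grassmann F) (@grassmann_scaleAr F).

(* The algebra morphism that extends f : nat -> A, when the f i anticommute   *)
(* and square to zero; see [grassmann_lift_is_monoid_morphism] below.         *)
Definition grassmann_lift (F : fieldType) (A : algType F) (f : nat -> A)
    (g : grassmann F) : A :=
  mmap (in_alg A) (fun S : {fset nat} => \prod_(i <- sort leq S) f i) g.

Section GrassmannTheory.
Context {F : fieldType}.
Implicit Types (S T : {fset nat}) (g : grassmann F).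

Local Notation e := (grassmann_gen F).

Lemma grassmann_gen_sq i : e i * e i = 0.
Proof.
rewrite /grassmann_gen grassmann_mulU /gsign fdisjoint1X in_fset1 eqxx.
by rewrite mulr0 monalgU0.
Qed.

Lemma grassmann_gen_anticomm i j : e i * e j = - (e j * e i).
Proof.
have [->|neq_ij] := eqVneq i j; first by rewrite grassmann_gen_sq oppr0.
rewrite /grassmann_gen !grassmann_mulU /gsign !fdisjoint1X !in_fset1.
rewrite [j == i]eq_sym neq_ij /ninv !big_seq_fset1 -monalgUN.
rewrite [[fset j; i]]fsetUC.
congr << _ *g _ >>; rewrite !mul1r.
by case: ltngtP neq_ij => //; rewrite expr0 expr1 ?opprK.
Qed.

Lemma grassmann_gen_consU i S (s : seq nat) : path ltn i s -> S =i s ->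
  e i * << S >> = << i |` S >>.
Proof.
move=> /(order_path_min ltn_trans)/allP lt_is eqS.
rewrite /grassmann_gen grassmann_mulU /gsign fdisjoint1X !mul1r.
rewrite eqS ifT; last by apply/negP => /lt_is; rewrite /= ltnn.
rewrite /ninv big_seq_fset1 big_seq big1 // => t; rewrite eqS => /lt_is /=.
by case: ltngtP.
Qed.

(* The basis element indexed by S is the ordered product of its generators.   *)
Lemma grassmann_monE S :
  << S >> = \prod_(i <- sort leq S) e i :> grassmann F.
Proof.
have: sorted ltn (sort leq S).
  by rewrite ltn_sorted_uniq_leq sort_uniq fset_uniq sort_sorted //; exact: leq_total.
have: S =i sort leq S by move=> i; rewrite mem_sort.
move: (sort leq S) => s; elim: s S => [|x s IH] S eqS.
  by move=> _; rewrite big_nil; congr << _ >>; apply/fsetP => i; rewrite eqS in_fset0.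
rewrite /= big_cons => lt_xs.
pose S' := [fset i in s]%fset.
have eqS' : S' =i s by move=> i; rewrite in_fset.
rewrite -(IH S') ?(path_sorted lt_xs) // (grassmann_gen_consU lt_xs) //.
by congr << _ >>; apply/fsetP => i; rewrite eqS in_fset1U eqS' inE.
Qed.

Section Lift.
Context (A : algType F) (f : nat -> A).
Local Notation lift := (grassmann_lift f).

Lemma grassmann_lift_is_zmod_morphism : zmod_morphism lift.
Proof. exact: mmap_is_additive. Qed.

HB.instance Definition _ :=
  GRing.isZmodMorphism.Build (grassmann F) A lift grassmann_lift_is_zmod_morphism.

Lemma grassmann_lift_is_scalable : scalable lift.
Proof.
move=> c g; rewrite /grassmann_lift (mmapEw (msuppZ_le _ _)) mmapE scaler_sumr.
by apply: eq_bigr => S _; rewrite mcoeffZ /= !mulr_algl scalerA.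
Qed.

HB.instance Definition _ :=
  GRing.isScalable.Build F (grassmann F) A *:%R lift grassmann_lift_is_scalable.

Lemma grassmann_liftU S : lift << S >> = \prod_(i <- sort leq S) f i.
Proof. by rewrite /grassmann_lift mmapU /= scale1r mul1r. Qed.

Lemma grassmann_lift_gen i : lift (e i) = f i.
Proof.
rewrite grassmann_liftU; set s := sort leq _.
suff -> : s = [:: i] by rewrite big_seq1.
apply: perm_small_eq => //; rewrite perm_sort.
by apply: uniq_perm => // [|j]; rewrite ?fset_uniq // in_fset1 inE.
Qed.

Hypothesis f_anticomm : forall i j, f i * f j = - (f j * f i).
Hypothesis f_sq : forall i, f i * f i = 0.

Lemma grassmann_prod_mem i (s : seq nat) :
  i \in s -> f i * \prod_(t <- s) f t = 0.
Proof.
elim: s => // x s IH; rewrite inE big_cons mulrA.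
case: eqVneq => [-> _|_ /= /IH fs0]; first by rewrite f_sq mul0r.
by rewrite f_anticomm mulNr -mulrA fs0 mulr0 oppr0.
Qed.

Lemma grassmann_prod_insert i (s : seq nat) : sorted leq s -> i \notin s ->
  f i * \prod_(t <- s) f t
  = (-1) ^+ (\sum_(t <- s) (t < i))%N *: \prod_(t <- sort leq (i :: s)) f t.
Proof.
have sortE (s1 s2 : seq nat) : sorted leq s2 -> perm_eq s1 s2 -> sort leq s1 = s2.
  move=> s2_sorted eq12; apply: (sorted_eq leq_trans anti_leq) => //.
    by apply: sort_sorted; exact: leq_total.
  by rewrite perm_sort.
elim: s => [|x s IH] /=.
  by move=> _ _; rewrite !big_nil (sortE _ [:: i]) // big_seq1 expr0 scale1r mulr1.
move=> xs; rewrite inE negb_or => /andP[neq_ix is_].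
have le_xs := allP (order_path_min leq_trans xs).
case: (ltngtP i x) neq_ix => // [lt_ix|lt_xi] _.
  rewrite (sortE _ [:: i, x & s]) /= ?(ltnW lt_ix) //.
  suff -> : (\sum_(t <- x :: s) (t < i) = 0)%N.
    by rewrite expr0 scale1r [RHS]big_cons.
  rewrite big_seq big1 // => t; rewrite inE => /predU1P[->|/le_xs le_xt].
    by rewrite ltnNge (ltnW lt_ix).
  by rewrite ltnNge (leq_trans (ltnW lt_ix)).
rewrite (sortE _ (x :: sort leq (i :: s))); first last.
- rewrite perm_sym -[i :: x :: s]/([:: i] ++ [:: x] ++ s) perm_sym perm_catCA /=.
  by rewrite perm_cons perm_sym perm_sort.
- rewrite /= path_sortedE; last exact: leq_trans.
  rewrite sort_sorted ?andbT; last exact: leq_total.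
  apply/allP => t; rewrite mem_sort inE => /predU1P[->|/le_xs //].
  exact: ltnW.
rewrite !big_cons lt_xi mulrA f_anticomm mulNr -mulrA IH ?(path_sorted xs) //.
by rewrite -scalerAr add1n exprS mulN1r scaleNr.
Qed.

Lemma grassmann_lift_genM i g : lift (e i * g) = f i * lift g.
Proof.
rewrite [g]monalgE mulr_sumr !(raddf_sum lift) mulr_sumr /=.
apply: eq_bigr => S _; set c := g@_S.
have -> : << c *g S >> = c *: (<< S >> : grassmann F).
  by rewrite grassmann_scaleU mulr1.
rewrite -scalerAr !linearZ /= -scalerAr grassmann_liftU; congr (_ *: _).
rewrite /grassmann_gen grassmann_mulU /gsign fdisjoint1X !mul1r.
have [iS|iS] /= := boolP (i \in S).
  by rewrite monalgU0 raddf0 grassmann_prod_mem // mem_sort.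
have sorted_S : sorted leq (sort leq S) by apply: sort_sorted; exact: leq_total.
rewrite grassmann_prod_insert ?mem_sort //.
rewrite -[_ ^+ _ in LHS]mulr1 -grassmann_scaleU linearZ /= grassmann_liftU.
congr (_ ^+ _ *: _).
  by rewrite /ninv big_seq_fset1; apply: perm_big; rewrite perm_sym perm_sort.
congr (\prod_(j <- _) _); apply/perm_sortP.
- exact: leq_total.
- exact: leq_trans.
- exact: anti_leq.
apply: uniq_perm; rewrite ?fset_uniq //=.
  by rewrite mem_sort iS sort_uniq fset_uniq.
by move=> j; rewrite in_fset1U !inE mem_sort.
Qed.

Lemma grassmann_lift_is_monoid_morphism : monoid_morphism lift.
Proof.
split.
  by rewrite [LHS](grassmann_liftU fset0) (_ : sort _ _ = [::]) ?big_nil //.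
move=> g1 g2; rewrite [g1]monalgE mulr_suml !(raddf_sum lift) mulr_suml /=.
apply: eq_bigr => S _; set c := g1@_S.
have -> : << c *g S >> = c *: (<< S >> : grassmann F).
  by rewrite grassmann_scaleU mulr1.
rewrite -scalerAl !linearZ /= -scalerAl grassmann_liftU; congr (_ *: _).
rewrite grassmann_monE; elim: (sort leq S) => [|i s IH].
  by rewrite !big_nil !mul1r.
by rewrite !big_cons -!mulrA grassmann_lift_genM IH.
Qed.

End Lift.

Lemma grassmann_morph_unique (A : algType F) (h k : {lrmorphism grassmann F -> A}) :
  (forall i, h (e i) = k (e i)) -> h =1 k.
Proof.
move=> eq_hk g; rewrite [g]monalgE !raddf_sum; apply: eq_bigr => S _ /=.
have -> : << g@_S *g S >> = g@_S *: (<< S >> : grassmann F).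
  by rewrite grassmann_scaleU mulr1.
rewrite !linearZ /= grassmann_monE !rmorph_prod; congr (_ *: _).
by apply: eq_bigr => i _; exact: eq_hk.
Qed.

End GrassmannTheory.

(* e_{i+1} |-> e_{i+1} if i+1 is even and e_{i+1} |-> - e_{i+1} otherwise.    *)
Definition phi_infty_gen (F : fieldType) (i : nat) : grassmann F :=
  if odd i.+1 then - grassmann_gen F i else grassmann_gen F i.

Definition phi_infty (F : fieldType) : grassmann F -> grassmann F :=
  grassmann_lift (@phi_infty_gen F).

Section PhiInfty.
Context {F : fieldType}.

HB.instance Definition _ := GRing.Linear.on (@phi_infty F).

Lemma phi_infty_is_monoid_morphism : monoid_morphism (@phi_infty F).
Proof.
apply: grassmann_lift_is_monoid_morphism => [i j|i]; rewrite /phi_infty_gen.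
  by case: ifP; case: ifP => _ _; rewrite ?mulNr ?mulrN ?mulNr ?opprK
    grassmann_gen_anticomm // ?opprK.
by case: ifP => _; rewrite ?mulNr ?mulrN ?opprK grassmann_gen_sq.
Qed.

HB.instance Definition _ :=
  GRing.isMonoidMorphism.Build (grassmann F) (grassmann F) (@phi_infty F)
    phi_infty_is_monoid_morphism.

Lemma phi_infty_genE i :
  phi_infty (grassmann_gen F i)
  = if odd i.+1 then - grassmann_gen F i else grassmann_gen F i.
Proof. exact: grassmann_lift_gen. Qed.

Lemma phi_inftyK : involutive (@phi_infty F).
Proof.
move=> g; apply: (@grassmann_morph_unique F _ (@phi_infty F \o @phi_infty F) idfun).
move=> i /=; rewrite !phi_infty_genE; case: ifP => odd_i.
  by rewrite raddfN /= phi_infty_genE odd_i opprK.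
by rewrite phi_infty_genE odd_i.
Qed.

End PhiInfty.

Arguments phi_infty : clear implicits.

(* [inl i] is the variable y_{i+1}, of degree 0; [inr i] is z_{i+1}, of       *)
(* degree 1. Degrees in Z_2 are booleans.                                     *)
Definition gvar : Type := (nat + nat)%type.
HB.instance Definition _ := Choice.on gvar.

Definition gvar_deg (x : gvar) : bool := if x is inr _ then true else false.

Notation "{ 'freealg' F }" := {malg F[{fmonom gvar}]}
  (at level 0, F at level 2, format "{ 'freealg'  F }") : type_scope.

Definition fvar (F : fieldType) (x : gvar) : {freealg F} := << fmu x >>.
Definition yvar (F : fieldType) (i : nat) : {freealg F} := fvar F (inl i).
Definition zvar (F : fieldType) (i : nat) : {freealg F} := fvar F (inr i).

Local Open Scope classical_set_scope.

Definition free_component (F : fieldType) (b : bool) : set {freealg F} :=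
  [set f | forall m : {fmonom gvar}, m \in msupp f ->
    odd (count gvar_deg m) = b].

Definition graded_endo (F : fieldType)
    (h : {lrmorphism {freealg F} -> {freealg F}}) : Prop :=
  forall (b : bool) (f : {freealg F}),
    free_component b f -> free_component b (h f).

(* Closure under scalars follows from closure under products, as the algebra  *)
(* is unitary.                                                                *)
Definition T2_ideal (F : fieldType) (I : set {freealg F}) : Prop :=
  [/\ I 0,
      forall f g, I f -> I g -> I (f + g),
      forall u f, I f -> I (u * f),
      forall f u, I f -> I (f * u) &
      forall h : {lrmorphism {freealg F} -> {freealg F}},
        graded_endo h -> forall f, I f -> I (h f)].

Definition T2_ideal_generated (F : fieldType) (S : set {freealg F}) :
    set {freealg F} :=
  smallest (@T2_ideal F) S.

Definition feval (F : fieldType) (A : algType F) (s : gvar -> A)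
    (f : {freealg F}) : A :=
  mmap (in_alg A) (fun m : {fmonom gvar} => \prod_(x <- m) s x) f.

Definition T2 (F : fieldType) (A : algType F) (A0 A1 : set A) :
    set {freealg F} :=
  [set f | forall s : gvar -> A,
    (forall i, A0 (s (inl i))) -> (forall i, A1 (s (inr i))) -> feval s f = 0].

Definition even_component (F : fieldType) (A : algType F) (phi : A -> A) :
    set A :=
  [set (2%:R : F)^-1 *: (a + phi a) | a in [set: A]].

Definition odd_component (F : fieldType) (A : algType F) (phi : A -> A) :
    set A :=
  [set (2%:R : F)^-1 *: (a - phi a) | a in [set: A]].

Definition commutator (R : nzRingType) (a b : R) : R := a * b - b * a.

Definition I2_generators (F : fieldType) (p q : nat) : set {freealg F} :=
  [set f | exists x1 x2 x3 : gvar,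
     f = commutator (commutator (fvar F x1) (fvar F x2)) (fvar F x3)]
  `|` [set zvar F 0 ^+ p; yvar F 0 ^+ (p * q) - yvar F 0 ^+ p].
Arguments I2_generators : clear implicits.

Definition I2 (F : fieldType) (p q : nat) : set {freealg F} :=
  T2_ideal_generated (I2_generators F p q).
Arguments I2 : clear implicits.

(* Main.v *)
Require Import Defs.
From HB Require Import structures.
From mathcomp Require Import all_boot all_order all_algebra.
From mathcomp Require Import finmap finfield.
From mathcomp.classical Require Import classical_sets.
From mathcomp.multinomials Require Import monalg.

Set Implicit Arguments.
Unset Strict Implicit.
Unset Printing Implicit Defensive.

Import GRing.Theory.
Local Open Scope fset_scope.
Local Open Scope ring_scope.

(** Write q for the order of F.

    The generators are identities. Monomials of even length are central in G
    and those of odd length anticommute, so commutators are central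
    ([grassmann_commutator_central]). As G has characteristic p and its
    nonconstant monomials square to 0, the p-th power of g is the p-th power
    of its constant term ([grassmann_frobenius]); the constant term is 0 when
    g is odd, and it is fixed by the q-th power map in any case.

    Conversely, modulo the ideal every polynomial in finitely many variables
    x_i is a combination of normal forms

      x_1 ^ a_1 ... x_n ^ a_n [x_{i_1}, x_{i_2}] ... [x_{i_{2k-1}}, x_{i_2k}]

    with i_1 < ... < i_2k, a_i < p q when x_i is even and a_i < p when x_i is
    odd ([spanned_mon]): commutators of variables are central, the product
    of commutators is alternating in all its arguments, and the power
    identities bound the exponents.

    It remains to see that a combination of normal forms which is an identity
    is zero ([normal_form_independent]). Among the sets S = {i_1, ..., i_2k}
    that occur, fix one of minimal size, and substitute

      x_i := c_i + (E_i1 + ... + E_im_i) + (e_i if i is in S),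

    where c_i is a scalar (0 for odd variables), the E_it are products of two
    generators, of the degree of x_i, and e_i is a generator of that degree,
    all of them distinct. The first two summands are central, so the terms of
    the other sets vanish, by minimality or because a commutator does. The
    terms of S contain the product of the e_i, i in S, which absorbs the third
    summand in the powers. As the E_it commute and square to 0, the
    coefficient of E_i1 ... E_im_i in (c_i + E_i1 + ... + E_im_i) ^ a is
    a (a - 1) ... (a - m_i + 1) c_i ^ (a - m_i), the value at c_i of the
    m_i-th derivative of X ^ a ([mcoeff_nilsum_exp]). For one even variable
    this says that a polynomial of degree less than p q has all its
    derivatives of order less than p equal to 0 at the q points of F; it is
    then divisible by the polynomial of degree p q that vanishes to order p at
    each of them, hence zero ([poly_taylor_independence]). For an odd variable
    the degree is less than p and the only point is 0. The case of several
    variables follows one variable at a time ([tensor_independence]). *)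

(** * Commutators *)

Section Commutators.
Context {R : nzRingType}.
Implicit Types a b d : R.

Lemma commutatorC a b : commutator a b = - commutator b a.
Proof. by rewrite /commutator opprB. Qed.

Lemma commutatorxx a : commutator a a = 0.
Proof. exact: subrr. Qed.

Lemma commutatorDl a b d :
  commutator (a + b) d = commutator a d + commutator b d.
Proof. by rewrite /commutator mulrDl mulrDr opprD addrACA. Qed.

Lemma commutatorMl a b d :
  commutator (a * b) d = a * commutator b d + commutator a d * b.
Proof. by rewrite /commutator mulrBr mulrBl !mulrA addrA subrK. Qed.

Lemma commutatorMr a b d :
  commutator d (a * b) = commutator d a * b + a * commutator d b.
Proof.
by rewrite commutatorC commutatorMl opprD -mulrN -mulNr -!commutatorC addrC.
Qed.

(** The identity behind the antisymmetry of products of two commutators: the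
    left-hand side lies in any ideal that contains the three triple
    commutators on the right. *)
Lemma commutator_swap_expand a b d e :
  commutator a b * commutator d e + commutator a d * commutator b e
  = a * commutator (commutator e b) d + commutator (commutator a b) d * e
    - commutator (commutator (a * e) b) d.
Proof.
rewrite (commutatorMl a e b) [commutator e b]commutatorC [commutator d e]commutatorC.
move: (commutator b e) (commutator a b) => u v.
rewrite (commutatorDl (a * - u)) (commutatorMl a (- u)) (commutatorMl v e d).
rewrite [v * commutator e d + _]addrC addrACA.
move: (a * commutator (- u) d + _) (commutator e d) (commutator a d) => w s t.
by rewrite opprD addNKr opprD !mulrN opprK addrC.
Qed.
End Commutators.

Lemma rmorph_commutator (R S : nzRingType) (h : {rmorphism R -> S}) a b :
  h (commutator a b) = commutator (h a) (h b).
Proof. by rewrite /commutator rmorphB !rmorphM. Qed.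

(** * Polynomial functions determined by their truncated Taylor expansions *)

Lemma pchar_two_neq0 (F : fieldType) (p : nat) :
  p \in [pchar F] -> (2 < p)%N -> 2%:R != 0 :> F.
Proof. by move=> charFp p_gt2; rewrite -(dvdn_pcharf charFp) gtnNdvd. Qed.

Section Univariate.
Context {F : fieldType} (p : nat).
Hypothesis charFp : p \in [pchar F].
Implicit Types (P : {poly F}) (c : F) (L : seq F).

(** The Taylor expansion of P at c, taken in the ring of polynomials with
    increment X - c. *)
Lemma dvdp_XsubC_exp n P c :
  (forall m, (m < n)%N -> P^`N(m).[c] = 0) -> ('X - c%:P) ^+ n %| P.
Proof.
move=> P0; have -> : P = \sum_(i < size (P^:P)) (P^`N(i).[c])%:P * ('X - c%:P) ^+ i.
  rewrite -[LHS]comp_polyXr /comp_poly -{1}['X](subrKC c%:P).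
  rewrite nderiv_taylor; last by rewrite /GRing.comm mulrC.
  by apply: eq_bigr => i _; rewrite nderivn_map horner_map.
apply: (big_ind (fun q => _ %| q)) => [|q r|i _]; rewrite ?dvdp0 //.
  exact: dvdp_add.
case: (ltnP i n) => [lt_in|le_ni]; first by rewrite P0 // mul0r dvdp0.
by rewrite dvdp_mull // dvdp_exp2l.
Qed.

Lemma nat_fact_neq0 m : (m < p)%N -> m`!%:R != 0 :> F.
Proof.
have p_pr := pcharf_prime charFp.
elim: m => [|m IHm] lt_mp; first by rewrite oner_eq0.
by rewrite factS natrM mulf_neq0 ?IHm // -?(dvdn_pcharf charFp) ?gtnNdvd // ltnW.
Qed.

Lemma dvdp_prod_XsubC_exp n L P : uniq L ->
    (forall c, c \in L -> ('X - c%:P) ^+ n %| P) ->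
  (\prod_(c <- L) ('X - c%:P)) ^+ n %| P.
Proof.
elim: L => [|c L IHL] /= => [_ _|/andP[cL uL] LP].
  by rewrite big_nil expr1n dvd1p.
rewrite big_cons exprMn Gauss_dvdp ?LP ?mem_head //=.
  by apply: IHL => // e eL; apply: LP; rewrite inE eL orbT.
apply/coprimep_expl/coprimep_expr.
by rewrite coprimep_sym coprimep_XsubC root_prod_XsubC.
Qed.

(** The hypothesis says that the derivatives of order less than p of the
    polynomial with coefficients k vanish on L. As m! is invertible for m < p,
    this polynomial has zeros of order p at the points of L, too many for its
    degree. *)
Lemma poly_taylor_independence L D (k : 'I_D -> F) : uniq L ->
    (forall a, k a != 0 -> (a < p * size L)%N) ->
    (forall c m, c \in L -> (m < p)%N ->
      \sum_a k a * ((a ^_ m)%:R * c ^+ (a - m)) = 0) ->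
  forall a, k a = 0.
Proof.
move=> uL k_small k0 a; pose P := \sum_(b < D) k b *: 'X^b.
have szP : (size P <= p * size L)%N.
  apply: leq_trans (size_sum _ _ _) _; apply/bigmax_leqP => b _.
  have [->|nz] := eqVneq (k b) 0.
    by rewrite scale0r size_poly0.
  by rewrite (leq_trans (size_scale_leq _ _)) // size_polyXn k_small.
have dvdP : (\prod_(c <- L) ('X - c%:P)) ^+ p %| P.
  apply: dvdp_prod_XsubC_exp => // c cL; apply: dvdp_XsubC_exp => m lt_mp.
  have: P^`(m).[c] = 0.
    rewrite -(k0 c m cL lt_mp) /P raddf_sum horner_sum; apply: eq_bigr => b _ /=.
    by rewrite derivnZ hornerZ derivnXn hornerMn hornerXn mulr_natl.
  rewrite nderivn_def hornerMn -mulr_natr => /eqP.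
  by rewrite mulf_eq0 (negPf (nat_fact_neq0 lt_mp)) orbF => /eqP.
have P0 : P = 0.
  apply: contraTeq dvdP => nzP; apply/negP => /(dvdp_leq nzP).
  rewrite leqNgt => /negP[]; apply: leq_ltn_trans szP _.
  have /monic_neq0 nzq := monic_exp p (monic_prod_XsubC L xpredT id).
  by rewrite (polySpred nzq) size_exp size_prod_XsubC mulnC.
have <- : P`_a = k a.
  rewrite /P coef_sum (bigD1 a) //= coefZ coefXn eqxx mulr1 big1 ?addr0 // => b nb.
  rewrite coefZ coefXn; have [/val_inj ab|_] := eqVneq (a : nat) b.
    by rewrite ab eqxx in nb.
  by rewrite mulr0.
by rewrite P0 coef0.
Qed.
End Univariate.

(** Tensor products of families of functionals that separate the functions on
    J separate the functions on J ^ V. The variables are released one at a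
    time: in [main], the sum runs over the functions with prescribed values
    outside D. *)
Lemma tensor_independence (F : fieldType) (V J : finType) (Q : Type)
    (vJ : V -> pred J) (wQ : V -> Q -> Prop) (B : V -> Q -> J -> F) (q0 : V -> Q) :
    (forall i, wQ i (q0 i)) ->
    (forall i (k : J -> F), (forall a, k a != 0 -> vJ i a) ->
       (forall q, wQ i q -> \sum_a k a * B i q a = 0) -> forall a, k a = 0) ->
  forall K : {ffun V -> J} -> F,
    (forall a, K a != 0 -> forall i, vJ i (a i)) ->
    (forall Qs : V -> Q, (forall i, wQ i (Qs i)) ->
       \sum_a K a * \prod_i B i (Qs i) (a i) = 0) ->
  forall a, K a = 0.
Proof.
move=> q0P indep K suppK K0.
pose agree (D : {set V}) (b a : {ffun V -> J}) := [forall i, (i \notin D) ==> (a i == b i)].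
suff main n D : #|~: D| = n -> forall b Qs, (forall i, wQ i (Qs i)) ->
    \sum_(a | agree D b a) K a * \prod_(i in D) B i (Qs i) (a i) = 0.
  move=> b; have := main _ finset.set0 erefl b q0 q0P; rewrite (big_pred1 b) => [|a].
    by rewrite big_set0 mulr1.
  apply/forallP/eqP => [ab|-> i]; last by rewrite eqxx implybT.
  by apply/ffunP => i; apply/eqP; have := ab i; rewrite inE.
elim: n D => [|n IHn] D szD b Qs QsP.
  have -> : D = finset.setT by rewrite -[D]finset.setCK (cards0_eq szD) finset.setC0.
  rewrite -[RHS](K0 Qs QsP); apply: eq_big => [a|a _].
    by apply/forallP => i; rewrite inE.
  by congr (_ * _); apply: eq_bigl => i; rewrite inE.
have [i iD] : exists i, i \in ~: D by apply/card_gt0P; rewrite szD.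
have szD' : #|~: (i |: D)| = n.
  apply/succn_inj; rewrite -szD (cardsD1 i (~: D)) iD.
  by rewrite finset.setCU finset.setIC finset.setDE.
pose k c := \sum_(a | agree (i |: D) b a && (a i == c))
  K a * \prod_(j in D) B j (Qs j) (a j).
have k0 : forall c, k c = 0.
  apply: (indep i) => [c nz|q wq].
    have [a /andP[_ /eqP<-] nza] : exists2 a, agree (i |: D) b a && (a i == c) &
        K a * \prod_(j in D) B j (Qs j) (a j) != 0.
      apply/exists_inP; apply: contraR nz => /exists_inPn z.
      by rewrite /k big1 // => a /z; rewrite negbK => /eqP.
    by move: nza; rewrite mulf_eq0 negb_or => /andP[/suppK].
  pose Qs' j := if j == i then q else Qs j.
  rewrite -[RHS](IHn _ szD' b Qs') => [|j]; last by rewrite /Qs'; case: eqP => [->|].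
  rewrite [RHS](partition_big (fun a : {ffun V -> J} => a i) predT) //=.
  apply: eq_bigr => c _; rewrite mulr_suml; apply: eq_bigr => a /andP[_ /eqP ai].
  rewrite big_setU1 /=; last by rewrite inE in iD.
  rewrite /Qs' eqxx ai -mulrA [_ * B _ _ _]mulrC; congr (_ * (_ * _)).
  apply: eq_bigr => j jD; case: eqP => // ji.
  by rewrite ji inE in iD jD; rewrite jD in iD.
rewrite -[RHS](k0 (b i)); apply: eq_bigl => a.
apply/forallP/andP => [ab|[/forallP ab /eqP abi] j].
  split; last by have := ab i; rewrite inE in iD; rewrite iD.
  apply/forallP => j; apply/implyP; rewrite in_setU1 negb_or => /andP[_ jD].
  by have := ab j; rewrite jD.
apply/implyP => jD; have [->|ji] := eqVneq j i; first by rewrite abi.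
by have := ab j; rewrite in_setU1 negb_or ji jD.
Qed.

(** * Straightening words modulo an ideal *)

(** Permutations are generated by adjacent transpositions: these bring the head
    of w to the front of w', and the tails are treated in the same way behind
    a common prefix s. *)
Lemma perm_swap_ind (T : eqType) (P : seq T -> Prop) :
    (forall w1 i j w2, P (w1 ++ j :: i :: w2) -> P (w1 ++ i :: j :: w2)) ->
  forall w w', perm_eq w w' -> P w' -> P w.
Proof.
move=> Pswap w; rewrite -[w in P w]cat0s => w'; rewrite -[w' in P w']cat0s.
move: [::] => s; elim: w => [|i w IHw] in s w' *.
  by rewrite perm_sym => /perm_nilP ->.
move=> eq_iw Pw'; have iw' : i \in w' by rewrite -(perm_mem eq_iw) mem_head.
case/splitPr: w' / iw' eq_iw Pw' => a b eq_iw Pab.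
have eq_w : perm_eq w (a ++ b).
  by rewrite -(perm_cons i) (perm_trans eq_iw) // perm_catC /= perm_cons perm_catC.
rewrite -cat_rcons; apply: IHw eq_w _; rewrite cat_rcons.
elim/last_ind: a b Pab {eq_iw} => [|a y IHa] b //=.
by rewrite !cat_rcons catA => Pab; apply: IHa; rewrite catA; exact: Pswap.
Qed.

(** The straightening is done in an arbitrary algebra, with a set I closed under
    the ideal operations and containing the relations it needs; [d i] bounds
    the exponent of [x i]. *)
Section Spanning.
Context {F : fieldType} {A : lalgType F} {V : finType} (x : V -> A).
Context (I : A -> Prop) (d : V -> nat) (D : nat).
Hypothesis I0 : I 0.
Hypothesis ID : forall f g, I f -> I g -> I (f + g).
Hypothesis IMl : forall u f, I f -> I (u * f).
Hypothesis IMr : forall f u, I f -> I (f * u).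
Local Notation c i j := (commutator (x i) (x j)).
Hypothesis I_comm3 : forall i j k, I (commutator (c i j) (x k)).
Hypothesis I_comm2_swap : forall i j k l, I (c i j * c k l + c i k * c j l).
Hypothesis I_pow : forall i,
  I (x i ^+ d i) \/ exists2 k, (k < d i)%N & I (x i ^+ d i - x i ^+ k).
Hypothesis d_le : forall i, (d i <= D)%N.

(** The product of the commutators of consecutive pairs; the value 0 on lists
    of odd length makes [commprod] alternating modulo I on all lists. *)
Fixpoint commprod (l : seq V) : A :=
  match l with
  | [::] => 1
  | [:: _] => 0
  | i :: j :: l' => c i j * commprod l'
  end.

Definition word (w : seq V) : A := \prod_(i <- w) x i.

Definition normal_form (a : {ffun V -> 'I_D}) (S : {set V}) : A :=
  (\prod_(i : V) x i ^+ a i) * commprod (enum S).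

Definition valid (a : {ffun V -> 'I_D}) (S : {set V}) : Prop :=
  (forall i, a i < d i)%N /\ ~~ odd #|S|.

Definition spanned (f : A) : Prop :=
  exists2 k : {ffun V -> 'I_D} -> {set V} -> F,
    forall a S, k a S != 0 -> valid a S &
    I (f - \sum_a \sum_S k a S *: normal_form a S).

Lemma spanned_congr f g : I (f - g) -> spanned g -> spanned f.
Proof.
move=> Ifg [k kv Ig]; exists k => //.
by rewrite -(subrKA g); exact: ID.
Qed.

Lemma spanned_ideal f : I f -> spanned f.
Proof.
move=> If; exists (fun _ _ => 0) => [a S|]; first by rewrite eqxx.
by rewrite big1 ?subr0 // => a _; rewrite big1 // => S _; rewrite scale0r.
Qed.

Lemma spanned_lin (t : F) f g : spanned f -> spanned g -> spanned (t *: f + g).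
Proof.
move=> [k kv If] [l lv Ig]; exists (fun a S => t * k a S + l a S) => [a S|].
  have [->|/kv //] := eqVneq (k a S) 0.
  by rewrite mulr0 add0r; exact: lv.
have -> : \sum_a \sum_S (t * k a S + l a S) *: normal_form a S
        = t *: (\sum_a \sum_S k a S *: normal_form a S)
          + \sum_a \sum_S l a S *: normal_form a S.
  rewrite scaler_sumr -big_split; apply: eq_bigr => a _ /=.
  rewrite scaler_sumr -big_split; apply: eq_bigr => S _ /=.
  by rewrite scalerDl scalerA.
rewrite opprD addrACA -scalerBr; apply: ID => //.
by rewrite -mulr_algl; exact: IMl.
Qed.

Lemma spanned_normal_form a S : valid a S -> spanned (normal_form a S).
Proof.
move=> v; exists (fun b T => ((b == a) && (T == S))%:R) => [b T|].
  by have [->|_] := eqVneq b a; have [->|_] := eqVneq T S; rewrite ?eqxx.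
rewrite (bigD1 a) //= (bigD1 S) //= !eqxx scale1r.
rewrite big1 => [|T /negPf neq_TS]; last by rewrite neq_TS ?andbF scale0r.
rewrite big1 => [|b /negPf neq_ba]; last first.
  by rewrite big1 // => T _; rewrite neq_ba scale0r.
by rewrite !addr0 subrr.
Qed.

Lemma ideal_comm_word i j w : I (commutator (c i j) (word w)).
Proof.
rewrite /word; elim: w => [|k w IHw].
  by rewrite big_nil /commutator mulr1 mul1r subrr.
by rewrite big_cons commutatorMr; apply: ID; [apply: IMr|apply: IMl].
Qed.

Definition mon w l := word w * commprod l.

(** Since x_i x_j = x_j x_i + [x_i, x_j] and the commutator is central modulo I,
    it can be moved to the commutator part, which leaves a shorter word. *)
Lemma mon_word_swap w1 i j w2 l :
  I (mon (w1 ++ i :: j :: w2) l - mon (w1 ++ j :: i :: w2) l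
     - mon (w1 ++ w2) (i :: j :: l)).
Proof.
rewrite /mon /word !big_cat !big_cons /=.
move: (\prod_(k <- w1) x k) (ideal_comm_word i j w2) => u; rewrite /word.
move: (\prod_(k <- w2) x k) (commprod l) => v w Iv.
have cv : c i j * v = x i * (x j * v) - x j * (x i * v).
  by rewrite /commutator mulrBl !mulrA.
move: (c i j) cv Iv => e ev; rewrite /commutator ev => Iv.
have -> : u * (x i * (x j * v)) * w - u * (x j * (x i * v)) * w - u * v * (e * w)
        = u * (x i * (x j * v) - x j * (x i * v) - v * e) * w.
  by rewrite !mulrBr !mulrBl !mulrA.
by apply/IMr/IMl.
Qed.

(** A transposition inside a pair is the antisymmetry of the commutator; one
    across two consecutive pairs is [I_comm2_swap]. *)
Lemma commprod_swap l1 i j l2 :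
  I (commprod (l1 ++ i :: j :: l2) + commprod (l1 ++ j :: i :: l2)).
Proof.
move: l1 l2; fix IH 1 => -[|a [|b l1]] l2 /=; last by rewrite -mulrDr; exact: IMl.
  by rewrite -mulrDl [c i j]commutatorC addNr mul0r.
case: l2 => [|b l2]; first by rewrite !mulr0 addr0.
by rewrite !mulrA -mulrDl; exact: IMr.
Qed.

Lemma commprod_odd l : odd (size l) -> commprod l = 0.
Proof.
move: l; fix IH 1 => -[|a [|b l]] //= odd_l.
by rewrite IH ?mulr0 // -(negbK (odd _)).
Qed.

Lemma spanned_mon_perm_comm w l l' :
  perm_eq l l' -> spanned (mon w l') -> spanned (mon w l).
Proof.
apply: (perm_swap_ind (P := fun l => spanned (mon w l))) => l1 i j l2 sp.
apply: (@spanned_congr _ (-1 *: mon w (l1 ++ j :: i :: l2) + 0)).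
  by rewrite addr0 scaleN1r opprK /mon -mulrDr; apply/IMl/commprod_swap.
by apply: spanned_lin => //; exact: spanned_ideal.
Qed.

Lemma spanned_mon_perm_word w w' l :
    (forall v m, (size v < size w)%N -> spanned (mon v m)) ->
  perm_eq w w' -> spanned (mon w' l) -> spanned (mon w l).
Proof.
move=> IH eq_w sp'; move: eq_w (sp') (perm_size eq_w) => eq_w.
pose P v := size v = size w -> spanned (mon v l).
suff PW : P w' -> P w by move=> sp sz; exact: PW.
apply: (perm_swap_ind _ eq_w) => w1 i j w2 Pji szw.
apply: (@spanned_congr _
  (1 *: mon (w1 ++ j :: i :: w2) l + mon (w1 ++ w2) (i :: j :: l))).
  by rewrite scale1r opprD addrA; exact: mon_word_swap.
apply: spanned_lin; first by apply: Pji; rewrite -szw !size_cat.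
by apply: IH; rewrite -szw !size_cat /= ltn_add2l ltnW.
Qed.

Lemma word_nseq n i : word (nseq n i) = x i ^+ n.
Proof.
elim: n => [|n IHn]; first by rewrite /word big_nil.
by rewrite /word big_cons -/(word _) IHn exprS.
Qed.

Lemma word_cat w w' : word (w ++ w') = word w * word w'.
Proof. exact: big_cat. Qed.

Lemma perm_nseq_front n i (w : seq V) : (n <= count_mem i w)%N ->
  exists w', perm_eq w (nseq n i ++ w').
Proof.
elim: n w => [|n IHn] w le_n; first by exists w.
have iw : i \in w by rewrite -has_pred1 has_count (leq_ltn_trans _ le_n).
case/splitPr: w / iw le_n => a b le_n.
have [|w' eq_ab] := IHn (a ++ b).
  by move: le_n; rewrite !count_cat /= eqxx addnCA.
exists w'; apply: (@perm_trans _ (i :: a ++ b)); last by rewrite /= perm_cons.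
by rewrite perm_catC /= perm_cons perm_catC.
Qed.

Lemma perm_nseq_index_enum (w : seq V) :
  perm_eq w (flatten [seq nseq (count_mem i w) i | i <- index_enum V]).
Proof.
apply/allP => j _ /=; rewrite count_flatten sumnE !big_map.
rewrite (bigD1 j) //= count_nseq /= eqxx mul1n big1 ?addn0 // => i /negPf neq_ij.
by rewrite count_nseq /= neq_ij.
Qed.

(** Induction on the length of the word. Up to shorter words its letters
    commute, so a letter that occurs at least d i times can be gathered in
    front, where the power relation shortens the word. Otherwise the letters
    are sorted; a repetition in the commutator part can be brought to the form
    [x_i, x_i]. *)
Lemma spanned_mon w l : spanned (mon w l).
Proof.
have [n] := ubnP (size w); elim: n w l => // n IHn w l; rewrite ltnS => le_wn.
have IH v m : (size v < size w)%N -> spanned (mon v m).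
  by move=> lt_vw; apply: IHn; exact: leq_trans le_wn.
have [/forallP small|/forallPn[i]] := boolP [forall i, count_mem i w < d i]%N; last first.
  rewrite -leqNgt => /perm_nseq_front[w' eq_w].
  apply: (spanned_mon_perm_word IH eq_w).
  rewrite /mon word_cat word_nseq -mulrA.
  have [Ixd|[k lt_kd Ixdk]] := I_pow i; first by apply: spanned_ideal; exact: IMr.
  apply: (@spanned_congr _ (mon (nseq k i ++ w') l)).
    by rewrite /mon word_cat word_nseq -mulrA -mulrBl; exact: IMr.
  apply: IH; rewrite (perm_size eq_w) !size_cat !size_nseq.
  by rewrite ltn_add2r.
have [uniq_l|] := boolP (uniq l); last first.
  move=> dup_l; have [i] : exists i, (1 < count_mem i l)%N.
    apply/existsP; apply: contraR dup_l => /existsPn le1.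
    apply: count_mem_uniq => i; move: (le1 i); rewrite -leqNgt -has_pred1 has_count.
    by case: (count_mem i l) => [|[]].
  case/perm_nseq_front => l' eq_l; apply: (spanned_mon_perm_comm eq_l).
  apply: spanned_ideal; rewrite /mon /= commutatorxx mul0r mulr0; exact: I0.
have eq_l : perm_eq l (enum [set i in l]).
  by apply: uniq_perm; rewrite ?enum_uniq // => i; rewrite mem_enum inE.
apply: (spanned_mon_perm_comm eq_l).
have [oddS|evenS] := boolP (odd #|[set i in l]|).
  apply: spanned_ideal; rewrite /mon commprod_odd ?mulr0 //; last by rewrite -cardE.
apply: (spanned_mon_perm_word IH (perm_nseq_index_enum w)).
pose a := [ffun i => Ordinal (leq_trans (small i) (d_le i))].
have -> : mon (flatten [seq nseq (count_mem i w) i | i <- index_enum V]) (enum [set i in l])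
   = normal_form a [set i in l].
  rewrite /mon /normal_form; congr (_ * _).
  elim: (index_enum V) => [|i s IHs]; first by rewrite /word !big_nil.
  by rewrite /= word_cat IHs big_cons word_nseq ffunE.
by apply: spanned_normal_form; split=> // i; rewrite ffunE; exact: small.
Qed.
End Spanning.

Lemma commprod_morph (F : fieldType) (A B : lalgType F) (V : finType)
    (h : {rmorphism A -> B}) (x : V -> A) l :
  h (commprod x l) = commprod (fun i => h (x i)) l.
Proof.
move: l; fix IH 1 => -[|i [|j l]] /=; rewrite ?rmorph1 ?rmorph0 //.
by rewrite rmorphM rmorph_commutator IH.
Qed.

Lemma commprod_central (F : fieldType) (A : lalgType F) (V : finType)
    (u a : V -> A) l : (forall i g, u i * g = g * u i) ->
  commprod (fun i => u i + a i) l = commprod a l.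
Proof.
move=> uC; have comm_ua i j : commutator (u i + a i) (u j + a j) = commutator (a i) (a j).
  have comm_u k g : commutator (u k) g = 0 by rewrite /commutator uC subrr.
  rewrite commutatorDl comm_u add0r commutatorC commutatorDl comm_u add0r.
  by rewrite -commutatorC.
by move: l; fix IH 1 => -[|i [|j l]] //=; rewrite IH comm_ua.
Qed.

(** * Evaluating the free algebra *)

Section FreeAlgebra.
Context {F : fieldType}.
Implicit Types (f g : {freealg F}) (m : {fmonom gvar}).

Lemma freealg_mulUU (c d : F) m m' :
  (<< c *g m >> : {freealg F}) * << d *g m' >> = << c * d *g mmul m m' >>.
Proof. by rewrite malgM_def fgmulUU. Qed.

Lemma freealg_scaleU (c d : F) m :
  c *: (<< d *g m >> : {freealg F}) = << c * d *g m >>.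
Proof. by apply/malgP => m'; rewrite mcoeffZ !mcoeffU mulrnAr. Qed.

Lemma freealg_scaleAr (c : F) f g : c *: (f * g) = f * (c *: g).
Proof.
rewrite [g]monalgE [in RHS]scaler_sumr !mulr_sumr scaler_sumr.
apply: eq_bigr => m _; rewrite [f]monalgE !mulr_suml scaler_sumr.
apply: eq_bigr => m' _.
by rewrite freealg_scaleU !freealg_mulUU freealg_scaleU mulrCA.
Qed.

Lemma freealg_monE m : << m >> = \prod_(x <- m) fvar F x :> {freealg F}.
Proof.
case: m => w; elim: w => [|x w IHw] /=.
  have -> : FMonom [::] = mone :> {fmonom gvar} by rewrite -fmoneE.
  by rewrite big_nil.
rewrite big_cons -IHw /fvar freealg_mulUU mulr1; congr << _ *g _ >>.
by rewrite /mmul /mul /= fmmulE fmuE.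
Qed.

Lemma freealgE f : f = \sum_(m <- msupp f) f@_m *: \prod_(x <- m) fvar F x.
Proof.
rewrite {1}[f]monalgE; apply: eq_bigr => m _.
by rewrite -freealg_monE freealg_scaleU mulr1.
Qed.

End FreeAlgebra.

(** The free algebra, with the structure that lets it receive evaluations. *)
Definition free_algebra (F : fieldType) : Type := {freealg F}.
HB.instance Definition _ (F : fieldType) :=
  GRing.Lalgebra.copy (free_algebra F) {freealg F}.
HB.instance Definition _ (F : fieldType) :=
  GRing.Lalgebra_isAlgebra.Build F (free_algebra F) (@freealg_scaleAr F).

Section Evaluation.
Context {F : fieldType} {A : algType F} (s : gvar -> A).
Implicit Types (f g : {freealg F}) (m : {fmonom gvar}).

Lemma feval_is_zmod_morphism : zmod_morphism (@feval F A s).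
Proof. exact: mmap_is_additive. Qed.

HB.instance Definition _ :=
  GRing.isZmodMorphism.Build {freealg F} A (@feval F A s) feval_is_zmod_morphism.

Lemma feval_is_scalable : scalable (@feval F A s).
Proof.
move=> c f; rewrite /feval (mmapEw (msuppZ_le _ _)) mmapE scaler_sumr.
by apply: eq_bigr => m _; rewrite mcoeffZ /= !mulr_algl scalerA.
Qed.

HB.instance Definition _ :=
  GRing.isScalable.Build F {freealg F} A *:%R (@feval F A s) feval_is_scalable.

Lemma fevalU c m : feval s << c *g m >> = c *: \prod_(x <- m) s x.
Proof. by rewrite /feval mmapU /= mulr_algl. Qed.

Lemma feval_is_monoid_morphism : monoid_morphism (@feval F A s).
Proof.
split; first by rewrite [LHS](fevalU 1 mone) scale1r fm1 big_nil.
move=> f g; rewrite [f]monalgE mulr_suml !raddf_sum mulr_suml /=.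
apply: eq_bigr => m _; rewrite [g]monalgE mulr_sumr !raddf_sum mulr_sumr /=.
apply: eq_bigr => m' _.
by rewrite freealg_mulUU !fevalU fmM big_cat /= -scalerAl -scalerAr scalerA.
Qed.

HB.instance Definition _ :=
  GRing.isMonoidMorphism.Build {freealg F} A (@feval F A s)
    feval_is_monoid_morphism.

Lemma feval_var x : feval s (fvar F x) = s x.
Proof. by rewrite fevalU fmU big_seq1 scale1r. Qed.

Lemma fevalE f : feval s f = \sum_(m <- msupp f) f@_m *: \prod_(x <- m) s x.
Proof. by rewrite {1}[f]monalgE raddf_sum; apply: eq_bigr => m _; rewrite /= fevalU. Qed.

Lemma feval_unique (h : {lrmorphism {freealg F} -> A}) f :
  (forall x, h (fvar F x) = s x) -> h f = feval s f.
Proof.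
move=> hs; rewrite fevalE {1}[f]freealgE raddf_sum; apply: eq_bigr => m _ /=.
by rewrite linearZ rmorph_prod; congr (_ *: _); apply: eq_bigr => x _ /=.
Qed.

(** A polynomial of degree b is evaluated into the component of degree b of any
    algebra graded by P, when the substitution respects degrees. *)
Lemma feval_graded (P : bool -> A -> Prop) b f :
    (forall c, P c 0) ->
    (forall c (k : F) a a', P c a -> P c a' -> P c (k *: a + a')) ->
    P false 1 ->
    (forall c d a a', P c a -> P d a' -> P (c (+) d) (a * a')) ->
    (forall x, P (gvar_deg x) (s x)) ->
  free_component b f -> P b (feval s f).
Proof.
move=> P0 PD P1 PM Ps fb; rewrite fevalE.
have Pprod (w : seq gvar) : P (odd (count gvar_deg w)) (\prod_(x <- w) s x).
  elim: w => [|x w IHw]; first by rewrite big_nil.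
  by rewrite big_cons /= oddD oddb; exact: PM.
rewrite big_seq; apply: (big_ind (P b)) => // [a a' Pa Pa'|m mf].
  by rewrite -[a]scale1r; exact: PD.
rewrite -[_ *: _]addr0; apply: PD; last exact: P0.
by rewrite -(fb m mf).
Qed.

End Evaluation.

Lemma free_component_fvar (F : fieldType) x :
  free_component (gvar_deg x) (fvar F x).
Proof.
by move=> m; rewrite /fvar msuppU1 in_fset1 => /eqP ->; rewrite fmU /= addn0 oddb.
Qed.

Section FreeComponents.
Context {F : fieldType}.

Lemma free_component_feval (s : gvar -> free_algebra F) :
    (forall x, free_component (gvar_deg x) (s x)) ->
  graded_endo (feval s : {lrmorphism {freealg F} -> free_algebra F}).
Proof.
move=> sP b f; apply: feval_graded sP.
- by move=> c m; rewrite msupp0.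
- move=> c k a a' ac ac' m /(fsubsetP (msuppD_le _ _)); rewrite in_fsetU.
  by case/orP => [/(fsubsetP (msuppZ_le _ _))/ac|/ac'].
- by move=> m; rewrite msuppU1 in_fset1 => /eqP ->; rewrite fm1.
- move=> c d a a' ac ad m /msuppM_le[m1 [m2 [m1a m2a' ->]]].
  by rewrite fmM count_cat oddD (ac m1 m1a) (ad m2 m2a').
Qed.
End FreeComponents.

(** * Consequences of the generators *)

Section T2IdealI2.
Context {F : fieldType} (p q : nat).
Local Notation I := (I2 F p q).

Lemma I2_T2_ideal : T2_ideal I.
Proof.
split.
- by move=> J [[]].
- move=> f g If Ig J IJ; have [[_ JD _ _ _] _] := IJ.
  by apply: JD; [exact: (If J)|exact: (Ig J)].
- by move=> u f If J IJ; have [[_ _ JL _ _] _] := IJ; apply: JL; exact: (If J).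
- by move=> f u If J IJ; have [[_ _ _ JR _] _] := IJ; apply: JR; exact: (If J).
- by move=> h hg f If J IJ; have [[_ _ _ _ Jh] _] := IJ; apply: Jh => //; exact: (If J).
Qed.

Lemma I2_0 : I 0. Proof. by case: I2_T2_ideal. Qed.
Lemma I2D f g : I f -> I g -> I (f + g).
Proof. by case: I2_T2_ideal => _ + _ _ _; apply. Qed.
Lemma I2Ml u f : I f -> I (u * f).
Proof. by case: I2_T2_ideal => _ _ + _ _; apply. Qed.
Lemma I2Mr f u : I f -> I (f * u).
Proof. by case: I2_T2_ideal => _ _ _ + _; apply. Qed.
Lemma I2N f : I f -> I (- f).
Proof. by rewrite -mulN1r; exact: I2Ml. Qed.
Lemma I2_feval (s : gvar -> free_algebra F) f :
  (forall x, free_component (gvar_deg x) (s x)) -> I f -> I (feval s f).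
Proof.
case: I2_T2_ideal => _ _ _ _ Ih sP If.
apply: (Ih (feval s : {lrmorphism {freealg F} -> free_algebra F})) => //.
exact: free_component_feval.
Qed.

Local Notation x := (fvar F).
Local Notation c i j := (commutator (x i) (x j)).

Lemma I2_comm3 i j k : I (commutator (c i j) (x k)).
Proof. by move=> J [_]; apply; left; exists i, j, k. Qed.

Lemma I2_zpow i : I (x (inr i) ^+ p).
Proof.
pose s (v : gvar) : free_algebra F := if v is inr _ then x (inr i) else x v.
suff: I (feval s (zvar F 0 ^+ p)) by rewrite rmorphXn /= feval_var.
apply: I2_feval => [[j|j]|J [_]]; try exact: free_component_fvar.
by apply; right; left.
Qed.

Lemma I2_ypow i : I (x (inl i) ^+ (p * q) - x (inl i) ^+ p).
Proof.
pose s (v : gvar) : free_algebra F := if v is inl _ then x (inl i) else x v.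
suff: I (feval s (yvar F 0 ^+ (p * q) - yvar F 0 ^+ p)).
  by rewrite raddfB /= !rmorphXn /= feval_var.
apply: I2_feval => [[j|j]|J [_]]; try exact: free_component_fvar.
by apply; right; right.
Qed.

(** Substituting a product x_i x_l for the first variable of the triple
    commutator and expanding. *)
Lemma I2_comm2_swap i j k l : I (c i j * c k l + c i k * c j l).
Proof.
pose v b n : gvar := if b then inr n else inl n.
have vdeg b n : gvar_deg (v b n) = b by case: b.
(* [v b n] is a variable of degree b; the indices 0, 1, 2 keep the three
   variables distinct whatever their degrees. *)
pose d := gvar_deg i (+) gvar_deg l.
pose s (u : gvar) : free_algebra F := if u == v d 0%N then x i * x l
  else if u == v (gvar_deg j) 1%N then x j
  else if u == v (gvar_deg k) 2%N then x k else x u.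
have s0 : s (v d 0%N) = x i * x l by rewrite /s eqxx.
have s1 : s (v (gvar_deg j) 1%N) = x j.
  by rewrite /s ifF ?eqxx //; case: (d); case: (gvar_deg j).
have s2 : s (v (gvar_deg k) 2%N) = x k.
  rewrite /s ifF; last by case: (d); case: (gvar_deg k).
  by rewrite ifF ?eqxx //; case: (gvar_deg j); case: (gvar_deg k).
have: I (feval s
    (commutator (c (v d 0%N) (v (gvar_deg j) 1%N)) (x (v (gvar_deg k) 2%N)))).
  apply: I2_feval; last exact: I2_comm3.
  move=> u; rewrite /s; case: eqP => [->|_].
    rewrite vdeg => m /msuppM_le[m1 [m2 [m1i m2l ->]]].
    by rewrite fmM count_cat oddD (free_component_fvar m1i) (free_component_fvar m2l).
  case: eqP => [->|_]; first by rewrite vdeg; exact: free_component_fvar.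
  case: eqP => [->|_]; first by rewrite vdeg; exact: free_component_fvar.
  exact: free_component_fvar.
rewrite !(rmorph_commutator (feval s)) /= !feval_var s0 s1 s2.
move=> If; have {If} : I (commutator (commutator (x i * x l) (x j)) (x k)) := If.
rewrite commutator_swap_expand => If.
apply: I2D; last exact: I2N.
by apply: I2D; [apply: I2Ml|apply: I2Mr]; exact: I2_comm3.
Qed.
End T2IdealI2.

(** * The Grassmann algebra and its grading *)

Lemma scalerMM (F : fieldType) (A : algType F) (k l : F) (x y : A) :
  (k *: x) * (l *: y) = (k * l) *: (x * y).
Proof. by rewrite -scalerAl -scalerAr scalerA. Qed.

(** Sealed, so that a monomial is never unfolded into a formal sum. *)
HB.lock Definition gmon (F : fieldType) (S : {fset nat}) : grassmann F := << S >>.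
Canonical gmon_unlockable := Unlockable gmon.unlock.

Section GrassmannMonomials.
Context {F : fieldType}.
Implicit Types (S T : {fset nat}) (g h a b : grassmann F).

Local Notation gmon := (gmon F).

Lemma gmonE g : g = \sum_(S <- msupp g) g@_S *: gmon S.
Proof.
rewrite {1}[g]monalgE; apply: eq_bigr => S _.
by rewrite unlock grassmann_scaleU mulr1.
Qed.

Lemma gmon_ind (P : grassmann F -> Prop) :
  P 0 -> (forall c S g, P g -> P (c *: gmon S + g)) -> forall g, P g.
Proof.
move=> P0 PS g; rewrite [g]gmonE.
by elim: (msupp g : seq _) => [|S s IH]; rewrite ?big_nil // big_cons; exact: PS.
Qed.

Lemma mcoeff_gmon S T : (gmon S)@_T = (S == T)%:R.
Proof. by rewrite unlock mcoeffU. Qed.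

Lemma gmonM S T : gmon S * gmon T = gsign F S T *: gmon (S `|` T).
Proof. by rewrite unlock grassmann_mulU grassmann_scaleU !mul1r mulr1. Qed.

Lemma gmon_sq S : S != fset0 -> gmon S * gmon S = 0.
Proof. by rewrite gmonM /gsign /fdisjoint fsetIid => /negPf ->; rewrite scale0r. Qed.

Lemma gmon0 : gmon fset0 = 1. Proof. by rewrite unlock. Qed.

(** Each pair of elements s, t is an inversion for exactly one of the two
    orders. *)
Lemma ninvC S T : [disjoint S & T] -> (ninv S T + ninv T S = #|` S| * #|` T|)%N.
Proof.
move=> dST; rewrite /ninv [X in (_ + X)%N]exchange_big -big_split /=.
rewrite -!sum1_size big_distrl /= big_seq [RHS]big_seq; apply: eq_bigr => s sS.
rewrite mul1n -big_split /= big_seq [RHS]big_seq; apply: eq_bigr => t tT.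
case: ltngtP => // eq_ts.
by move/fdisjointP: dST => /(_ s sS); rewrite -eq_ts tT.
Qed.

Lemma gmonC S T :
  gmon S * gmon T = (-1) ^+ (odd #|` S| && odd #|` T|) *: (gmon T * gmon S).
Proof.
rewrite !gmonM scalerA fsetUC; congr (_ *: _).
rewrite /gsign [in RHS]fdisjoint_sym -oddM signr_odd.
case: ifP => dST; last by rewrite mulr0.
rewrite -ninvC // -exprD -signr_odd -[RHS]signr_odd.
by rewrite !oddD -addbA addbb addbF.
Qed.

(** Parity of the length of the monomials, which governs commutation; it is
    not the parity of the grading defined by [phi_infty]. *)
Definition gpure (c : bool) g : Prop :=
  forall S, S \in msupp g -> odd #|` S| = c.

Lemma gpureC c d g h : gpure c g -> gpure d h ->
  g * h = (-1) ^+ (c && d) *: (h * g).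
Proof.
move=> gc hd; rewrite [g]gmonE [h]gmonE !big_distrlr [in RHS]exchange_big /=.
rewrite scaler_sumr big_seq [RHS]big_seq; apply: eq_bigr => S Sg.
rewrite scaler_sumr big_seq [RHS]big_seq; apply: eq_bigr => T Th.
rewrite !scalerMM gmonC (gc _ Sg) (hd _ Th) !scalerA.
by congr (_ *: _); rewrite mulrC [h@_T * _]mulrC.
Qed.

Lemma gpure_split g : exists a b, [/\ g = a + b, gpure false a & gpure true b].
Proof.
pose part c := \sum_(S <- msupp g | odd #|` S| == c) g@_S *: gmon S.
have part_pure c : gpure c (part c).
  move=> S; rewrite -mcoeff_neq0 /part raddf_sum /= => nz.
  apply/eqP; apply: contraNT nz => oddS; rewrite big1 // => T oddT.
  rewrite mcoeffZ mcoeff_gmon.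
  have [eqTS|_] := eqVneq T S; first by rewrite -eqTS oddT in oddS.
  by rewrite mulr0.
exists (part false), (part true); split=> //.
rewrite {1}[g]gmonE (bigID (fun S => odd #|` S| == false)) /=; congr (_ + _).
by apply: eq_bigl => S; case: odd.
Qed.

Lemma gpure_false_central a g : gpure false a -> a * g = g * a.
Proof.
move=> a0; have [b [c [-> b0 c1]]] := gpure_split g.
by rewrite mulrDl mulrDr (gpureC a0 b0) (gpureC a0 c1) !scale1r.
Qed.

Lemma gmon_central S g : ~~ odd #|` S| -> gmon S * g = g * gmon S.
Proof.
move=> evenS; apply: gpure_false_central => T.
by rewrite gmon.unlock msuppU oner_eq0 in_fset1 => /eqP ->; exact: negbTE.
Qed.
(** Only the odd-length parts contribute to a commutator, which is therefore
    twice a product of two elements of odd length, and such products commute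
    with elements of either parity. *)
Lemma grassmann_commutator_central a b g :
  commutator (commutator a b) g = 0.
Proof.
have [a0 [a1 [-> a0p a1p]]] := gpure_split a.
have [b0 [b1 [-> b0p b1p]]] := gpure_split b.
have [g0 [g1 [-> g0p g1p]]] := gpure_split g.
have a0C x := gpure_false_central x a0p; have b0C x := gpure_false_central x b0p.
have anti x y : gpure true x -> gpure true y -> x * y = - (y * x).
  by move=> xp yp; rewrite (gpureC xp yp) expr1 scaleN1r.
have -> : commutator (a0 + a1) (b0 + b1) = a1 * b1 *+ 2.
  rewrite /commutator mulrDl a0C [in X in _ - X]mulrDr opprD addrACA subrr add0r.
  rewrite mulrDr mulrDl -b0C opprD addrACA subrr add0r.
  by rewrite (anti b1 a1) // opprK mulr2n.
have g1C : a1 * b1 * g1 = g1 * (a1 * b1).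
  rewrite -mulrA (anti b1 g1) // mulrN [a1 * (_ * _)]mulrA (anti a1 g1) //.
  by rewrite mulNr opprK mulrA.
apply/eqP; rewrite /commutator subr_eq0 mulrnAl mulrnAr mulrDr mulrDl g1C.
by rewrite (gpure_false_central _ g0p).
Qed.

Section Frobenius.
Context (p : nat) (charFp : p \in [pchar F]) (p_gt2 : (2 < p)%N).

Let charGp : p \in [pchar (grassmann F)].
Proof. by rewrite pchar_lalg. Qed.

Let two_neq0 : 2%:R != 0 :> F := pchar_two_neq0 charFp p_gt2.

Lemma gpure_true_sq a : gpure true a -> a * a = 0.
Proof.
move=> ap; have /eqP := gpureC ap ap; rewrite expr1 scaleN1r -addr_eq0 -mulr2n.
by rewrite -scaler_nat scaler_eq0 (negPf two_neq0) => /eqP.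
Qed.

Lemma gpure_true_coef0 a : gpure true a -> a@_fset0 = 0.
Proof.
move=> ap; apply/eqP; rewrite mcoeff_eq0; apply/negP => /ap.
by rewrite cardfs0.
Qed.

(** The p-th power map is additive on commuting elements. It kills the part of
    odd length, whose square is 0, and every monomial but 1. *)
Lemma grassmann_frobenius g : g ^+ p = (g@_fset0 ^+ p)%:A.
Proof.
have exprDp (x y : grassmann F) : GRing.comm x y -> (x + y) ^+ p = x ^+ p + y ^+ p.
  by move=> cxy; rewrite -!(pFrobenius_autE charGp) pFrobenius_autD_comm.
have p_gt0 : (0 < p)%N by apply: ltn_trans p_gt2.
have [a [b [-> ap bp]]] := gpure_split g.
have bpow : b ^+ p = 0.
  by rewrite -(subnKC (ltnW p_gt2)) exprD expr2 gpure_true_sq // mul0r.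
rewrite exprDp; last exact: gpure_false_central.
rewrite bpow addr0 mcoeffD (gpure_true_coef0 bp) addr0 => {b bp bpow}.
pose frob (x : grassmann F) := (forall y, x * y = y * x) /\ x ^+ p = (x@_fset0 ^+ p)%:A.
suff: frob a by case.
rewrite [a]gmonE big_seq; apply: (big_ind frob) => [|x y [xC Ex] [yC Ey]|S Sa].
- split=> [y|]; first by rewrite mul0r mulr0.
  by rewrite mcoeff0 !expr0n gtn_eqF // mulr0n scale0r.
- split=> [z|]; first by rewrite mulrDl mulrDr xC yC.
  have eD : (x + y)@_fset0 ^+ p = x@_fset0 ^+ p + y@_fset0 ^+ p.
    by rewrite mcoeffD -!(pFrobenius_autE charFp) rmorphD.
  by rewrite (exprDp _ _ (xC y)) Ex Ey eD scalerDl.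
- split=> [z|].
    apply: gpure_false_central => T.
    have [-> _|] := eqVneq T S; first exact: (ap S Sa).
    rewrite eq_sym -mcoeff_neq0 mcoeffZ mcoeff_gmon => /negPf ->.
    by rewrite mulr0 eqxx.
  rewrite exprZn mcoeffZ mcoeff_gmon.
  have [->|nzS] := eqVneq S fset0; first by rewrite gmon0 !expr1n mulr1.
  have -> : gmon S ^+ p = 0.
    by rewrite -(subnKC (ltnW p_gt2)) exprD expr2 gmon_sq // mul0r.
  by rewrite scaler0 mulr0 expr0n gtn_eqF // scale0r.
Qed.
End Frobenius.

(** The degree of a monomial for the grading of G, up to parity: position i
    stands for e_{i+1}, which is odd when i is even. *)
Definition zdeg S : nat := \sum_(i <- S) ~~ odd i.

Lemma zdegU S T : [disjoint S & T]%fset -> zdeg (S `|` T) = (zdeg S + zdeg T)%N.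
Proof. by move=> dST; rewrite /zdeg (perm_big _ (perm_fsetU dST)) big_cat. Qed.

Lemma zdeg1 n : zdeg [fset n] = ~~ odd n.
Proof. by rewrite /zdeg big_seq_fset1. Qed.
Lemma phi_infty_gmon S : phi_infty F (gmon S) = (-1) ^+ zdeg S *: gmon S.
Proof.
rewrite unlock grassmann_monE rmorph_prod /zdeg -(perm_big _ (permEl (perm_sort leq S))) /=.
elim: (sort leq S) => [|i s IH]; first by rewrite !big_nil scale1r.
rewrite !big_cons IH phi_infty_genE -scalerAr exprD -scalerA /=.
case: (odd i) => /=; first by rewrite expr0 scale1r.
by rewrite expr1 scaleN1r mulNr scalerN.
Qed.

Lemma mcoeff_phi_infty g S : (phi_infty F g)@_S = (-1) ^+ zdeg S * g@_S.
Proof.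
elim/gmon_ind: g => [|c T g IH]; first by rewrite raddf0 !mcoeff0 mulr0.
have -> : phi_infty F (c *: gmon T + g) = c *: phi_infty F (gmon T) + phi_infty F g.
  exact: linearP.
rewrite phi_infty_gmon !mcoeffD IH mulrDr; congr (_ + _).
rewrite !mcoeffZ mcoeff_gmon.
by case: eqP => [->|_]; rewrite ?mulr0 // !mulr1 mulrC.
Qed.

Section Components.
Context (two_neq0 : 2%:R != 0 :> F).

Lemma even_componentP g :
  even_component (phi_infty F) g <-> phi_infty F g = g.
Proof.
split=> [[a _ <-]|phig].
  by rewrite linearZ raddfD /= phi_inftyK addrC.
by exists g => //; rewrite phig -mulr2n -scaler_nat scalerA mulVf ?scale1r.
Qed.

Lemma odd_componentP g :
  odd_component (phi_infty F) g <-> phi_infty F g = - g.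
Proof.
split=> [[a _ <-]|phig].
  by rewrite linearZ raddfB /= phi_inftyK -scalerN opprB.
by exists g => //; rewrite phig opprK -mulr2n -scaler_nat scalerA mulVf ?scale1r.
Qed.

Lemma odd_component_coef0 g : phi_infty F g = - g -> g@_fset0 = 0.
Proof.
move=> /(congr1 (fun h => h@_fset0)); rewrite mcoeff_phi_infty mcoeffN.
rewrite /zdeg big_seq_fset0 mul1r => /eqP.
by rewrite -addr_eq0 -mulr2n -mulr_natl mulf_eq0 (negPf two_neq0) => /eqP.
Qed.
End Components.
End GrassmannMonomials.

(** * The generators are identities *)

Section Soundness.
Context {F : finFieldType} (p : nat).
Context (charFp : p \in [pchar F]) (p_gt2 : (2 < p)%N).

Let two_neq0 : 2%:R != 0 :> F := pchar_two_neq0 charFp p_gt2.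

Definition gcomponent (b : bool) : set (grassmann F) :=
  if b then odd_component (phi_infty F) else even_component (phi_infty F).

Lemma gcomponentP b g : gcomponent b g <-> phi_infty F g = (-1) ^+ b *: g.
Proof.
case: b; rewrite /gcomponent.
  by rewrite expr1 scaleN1r; exact: odd_componentP.
by rewrite expr0 scale1r; exact: even_componentP.
Qed.

Local Notation T2G :=
  (T2 (even_component (phi_infty F)) (odd_component (phi_infty F))).

Lemma T2GP f : T2G f <-> forall s : gvar -> grassmann F,
  (forall x, gcomponent (gvar_deg x) (s x)) -> feval s f = 0.
Proof.
split=> f0 s sP; last by move=> s1; apply: f0 => -[] i; [exact: sP|exact: s1].
by apply: f0 => i; [exact: (sP (inl i))|exact: (sP (inr i))].
Qed.

Lemma gcomponent_feval (s : gvar -> grassmann F) b f :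
    (forall x, gcomponent (gvar_deg x) (s x)) ->
  free_component b f -> gcomponent b (feval s f).
Proof.
move=> sP; apply: feval_graded => //.
- by move=> c; apply/gcomponentP; rewrite raddf0 scaler0.
- move=> c k a a' /gcomponentP Ea /gcomponentP Ea'; apply/gcomponentP.
  have -> : phi_infty F (k *: a + a') = k *: phi_infty F a + phi_infty F a'.
    exact: linearP.
  by rewrite Ea Ea' scalerDr !scalerA mulrC.
- by apply/gcomponentP; rewrite rmorph1 scale1r.
- move=> c d a a' /gcomponentP Ea /gcomponentP Ea'; apply/gcomponentP.
  have -> : phi_infty F (a * a') = phi_infty F a * phi_infty F a' by exact: rmorphM.
  rewrite Ea Ea' scalerMM; congr (_ *: _).
  by rewrite signr_addb.
Qed.

(** A graded endomorphism followed by a graded substitution is again a graded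
    substitution. *)
Lemma T2G_T2_ideal : T2_ideal T2G.
Proof.
split.
- by apply/T2GP => s _; rewrite raddf0.
- by move=> f g /T2GP f0 /T2GP g0; apply/T2GP => s sP; rewrite raddfD /= f0 ?g0 ?addr0.
- by move=> u f /T2GP f0; apply/T2GP => s sP; rewrite rmorphM /= f0 ?mulr0.
- by move=> f u /T2GP f0; apply/T2GP => s sP; rewrite rmorphM /= f0 ?mul0r.
- move=> h hgr f /T2GP f0; apply/T2GP => s sP.
  rewrite -[LHS]/((feval s \o h) f).
  rewrite (@feval_unique F _ (fun x => feval s (h (fvar F x)))) //.
  by apply: f0 => x; apply: gcomponent_feval => //; apply/hgr/free_component_fvar.
Qed.

Lemma I2_sub_T2G : (I2 F p #|F| `<=` T2G)%classic.
Proof.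
apply: smallest_sub; first exact: T2G_T2_ideal.
move=> f [[x1 [x2 [x3 ->]]]|[->|->]]; apply/T2GP => s sP.
- by rewrite !(rmorph_commutator (feval s)) grassmann_commutator_central.
- rewrite rmorphXn /= feval_var (grassmann_frobenius charFp) //.
  rewrite (odd_component_coef0 two_neq0).
    by rewrite expr0n gtn_eqF ?scale0r // prime_gt0 // (pcharf_prime charFp).
  by have /gcomponentP := sP (inr 0%N); rewrite expr1 scaleN1r.
- rewrite raddfB /= !rmorphXn /= feval_var exprM (grassmann_frobenius charFp) //.
  by rewrite -(in_algE (grassmann F)) -rmorphXn /= expf_card subrr.
Qed.
End Soundness.

(** * Coefficients of products with disjoint supports *)

Section DisjointSupports.
Context {F : fieldType}.
Implicit Types (S T A B : {fset nat}) (g h : grassmann F) (P Q : pred nat).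
Local Notation gmon := (gmon F).

Definition supported P g : Prop :=
  forall S, S \in msupp g -> {subset S <= P}.

Lemma supported_gmon S P : {subset S <= P} -> supported P (gmon S).
Proof.
by move=> SP T; rewrite gmon.unlock msuppU oner_eq0 in_fset1 => /eqP ->.
Qed.

Lemma supported1 P : supported P 1.
Proof. by rewrite -gmon0; apply: supported_gmon => n. Qed.

Lemma supportedD P g h : supported P g -> supported P h -> supported P (g + h).
Proof.
move=> gP hP S /(fsubsetP (msuppD_le _ _)); rewrite in_fsetU.
by case/orP => [/gP|/hP].
Qed.

Lemma supportedZ P (c : F) g : supported P g -> supported P (c *: g).
Proof. by move=> gP S /(fsubsetP (msuppZ_le _ _))/gP. Qed.

Lemma supported0 P : supported P 0.
Proof. by move=> S; rewrite msupp0. Qed.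

Lemma supportedM P g h : supported P g -> supported P h -> supported P (g * h).
Proof.
move=> gP hP; rewrite [g]gmonE [h]gmonE big_distrlr /=.
rewrite big_seq; apply: (big_ind (supported P)) => [||S Sg].
- exact: supported0.
- exact: supportedD.
rewrite big_seq; apply: (big_ind (supported P)) => [||T Th].
- exact: supported0.
- exact: supportedD.
rewrite scalerMM gmonM; apply/supportedZ/supportedZ/supported_gmon => n.
by rewrite in_fsetU => /orP[|]; [apply: gP|apply: hP].
Qed.

Lemma supportedX P g n : supported P g -> supported P (g ^+ n).
Proof.
by move=> gP; elim: n => [|n IHn]; [exact: supported1|rewrite exprS; exact: supportedM].
Qed.

Lemma supported_prod (I : Type) (r : seq I) P (g : I -> grassmann F) :
  (forall i, supported P (g i)) -> supported P (\prod_(i <- r) g i).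
Proof.
by move=> gP; apply: big_ind => //; [exact: supported1|exact: supportedM].
Qed.

Lemma supportedS P Q g : {subset P <= Q} -> supported P g -> supported Q g.
Proof. by move=> PQ gP S /gP SP n /SP /PQ. Qed.

Lemma mcoeff_supported P g A n : supported P g -> n \in A -> n \notin P -> g@_A = 0.
Proof.
move=> gP nA nP; apply/eqP; rewrite mcoeff_eq0; apply: contra nP => /gP; exact.
Qed.

Lemma gsign_neq0 A B : [disjoint A & B] -> gsign F A B != 0.
Proof. by rewrite /gsign => ->; rewrite signr_eq0. Qed.

(** Disjointness of P and Q makes the pair (A, B) the only one that contributes
    to the coefficient of the union. *)
Lemma mcoeffM_disjoint P Q g h A B :
    supported P g -> supported Q h -> {subset A <= P} -> {subset B <= Q} ->
    (forall n, n \in P -> n \notin Q) ->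
  (g * h)@_(A `|` B) = gsign F A B * g@_A * h@_B.
Proof.
move=> gP hQ AP BQ PQ.
have eqU S T : {subset S <= P} -> {subset T <= Q} ->
    (S `|` T == A `|` B) = (S == A) && (T == B).
  move=> SP TQ; apply/eqP/andP => [eqST|[/eqP-> /eqP->] //].
  have mem_eq n : (n \in S) = (n \in A) /\ (n \in T) = (n \in B).
    have := congr1 (fun X => n \in X) eqST; rewrite !in_fsetU.
    have [nP|nP] := boolP (n \in P).
      by rewrite (contraNF (TQ n) (PQ n nP)) (contraNF (BQ n) (PQ n nP)) !orbF.
    by rewrite (contraNF (SP n) nP) (contraNF (AP n) nP).
  by split; apply/eqP/fsetP => n; case: (mem_eq n).
have mono (S T : {fset nat}) (c e : F) : {subset S <= P} -> {subset T <= Q} ->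
    ((c *: gmon S) * (e *: gmon T))@_(A `|` B)
    = gsign F A B * (c * (S == A)%:R) * (e * (T == B)%:R).
  move=> SP TQ; rewrite scalerMM gmonM scalerA mcoeffZ mcoeff_gmon eqU //.
  have [->|_] := eqVneq S A; have [->|_] := eqVneq T B;
    rewrite ?mulr0 ?mul0r ?mulr1 //.
  by rewrite mulrC mulrA.
have coefE (k : grassmann F) X : k@_X = \sum_(S <- msupp k) k@_S * (S == X)%:R :> F.
  rewrite {1}[k]gmonE [LHS](raddf_sum (mcoeff X)) /=.
  by apply: eq_bigr => S _; rewrite mcoeffZ mcoeff_gmon.
have -> : (g * h)@_(A `|` B) = \sum_(S <- msupp g) \sum_(T <- msupp h)
    ((g@_S *: gmon S) * (h@_T *: gmon T))@_(A `|` B).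
  rewrite {1}[g]gmonE {1}[h]gmonE big_distrlr [LHS](raddf_sum (mcoeff _)) /=.
  by apply: eq_bigr => S _; rewrite [LHS](raddf_sum (mcoeff _)).
rewrite (coefE g A) (coefE h B) -mulrA big_distrlr mulr_sumr.
rewrite big_seq [RHS]big_seq; apply: eq_bigr => S Sg.
rewrite mulr_sumr big_seq [RHS]big_seq; apply: eq_bigr => T Th.
by rewrite mono ?mulrA //; [exact: gP|exact: hQ].
Qed.

Section Products.
Context {V : eqType} (P : V -> pred nat) (A : V -> {fset nat}).
Hypothesis P_disj : forall i j n, n \in P i -> n \in P j -> i = j.
Hypothesis A_sub : forall i, {subset A i <= P i}.
Local Notation bigA s := (\big[@fsetU _/fset0]_(i <- s) A i).

Lemma mem_bigA (s : seq V) n : (n \in bigA s) = has (fun i => n \in A i) s.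
Proof.
elim: s => [|i s IHs]; first by rewrite big_nil in_fset0.
by rewrite big_cons in_fsetU IHs.
Qed.

Let Q (s : seq V) : pred nat := fun n => has (fun i => n \in P i) s.

Let PQ_disj i s n : i \notin s -> n \in P i -> n \notin Q s.
Proof.
move=> is_ nPi; apply/hasPn => j js; apply/negP => /(P_disj nPi) ij.
by rewrite ij js in is_.
Qed.

Let bigA_sub s : {subset bigA s <= Q s}.
Proof.
move=> n; rewrite mem_bigA => /hasP[i is_ nA]; apply/hasP; exists i => //; exact: A_sub.
Qed.

(** The constant is a product of signs. It depends on the sets only, so that a
    linear relation between several products gives the same relation between
    the products of the coefficients. *)
Lemma mcoeff_prod_disjoint (s : seq V) : uniq s ->
  exists2 c : F, c != 0 & forall g : V -> grassmann F,
    (forall i, supported (P i) (g i)) ->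
    (\prod_(i <- s) g i)@_(bigA s) = c * \prod_(i <- s) (g i)@_(A i).
Proof.
elim: s => [_|i s IHs /=/andP[is_ us]].
  by exists 1 => [|g _]; rewrite ?oner_neq0 // !big_nil mulr1 -gmon0 mcoeff_gmon eqxx.
have [c nzc IHc] := IHs us; exists (gsign F (A i) (bigA s) * c).
  rewrite mulf_neq0 // gsign_neq0 //; apply/fdisjointP => n /A_sub nPi.
  by apply: contra (PQ_disj is_ nPi) => /bigA_sub.
move=> g gP; rewrite !big_cons.
rewrite (@mcoeffM_disjoint (P i) (Q s)) ?IHc //; last first.
- by move=> n nPi; exact: PQ_disj nPi.
- rewrite big_seq; apply: big_ind => [||j js]; [exact: supported1|exact: supportedM|].
  by apply: supportedS (gP j) => n nPj; apply/hasP; exists j.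
by rewrite -!mulrA; congr (_ * _); rewrite mulrCA.
Qed.

Lemma prod_gmon_disjoint (s : seq V) : uniq s ->
  exists2 c : F, c != 0 & \prod_(i <- s) gmon (A i) = c *: gmon (bigA s).
Proof.
elim: s => [_|i s IHs /=/andP[is_ us]].
  by exists 1; rewrite ?oner_neq0 // !big_nil gmon0 scale1r.
have [c nzc IHc] := IHs us; exists (c * gsign F (A i) (bigA s)).
  rewrite mulf_neq0 // gsign_neq0 //; apply/fdisjointP => n /A_sub nPi.
  by apply: contra (PQ_disj is_ nPi) => /bigA_sub.
by rewrite !big_cons IHc -scalerAr gmonM scalerA.
Qed.
End Products.

Lemma exprD_sq0 (R : nzRingType) (a b : R) n : GRing.comm a b -> b * b = 0 ->
  (a + b) ^+ n = a ^+ n + (a ^+ n.-1 * b) *+ n.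
Proof.
move=> ab b0; have abX k : b * a ^+ k = a ^+ k * b.
  by apply/commrX/commr_sym.
elim: n => [|n IHn]; first by rewrite !expr0 mulr0n addr0.
rewrite exprS IHn mulrDl !mulrDr -exprS -addrA; congr (_ + _).
rewrite !mulrnAr !mulrA !abX -[a ^+ n.-1 * b * b]mulrA b0 mulr0 mul0rn addr0.
case: n {IHn} => [|n] /=; first by rewrite mulr0n add0r.
by rewrite -exprS -mulrSr.
Qed.

Section GenericNilpotent.
Context (E : nat -> {fset nat}) (P : nat -> pred nat).
Hypothesis E_even : forall t, ~~ odd #|` E t|.
Hypothesis E_neq0 : forall t, E t != fset0.
Hypothesis E_sub : forall t, {subset E t <= P t}.
Hypothesis P_disj : forall t u n, n \in P t -> n \in P u -> t = u.

(** The generic central element: a scalar plus m commuting elements of square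
    zero. *)
Definition nilsum (c : F) m : grassmann F := c%:A + \sum_(t < m) gmon (E t).
Definition bigE m : {fset nat} := \big[@fsetU _/fset0]_(t < m) E t.

Lemma nilsum_central c m g : nilsum c m * g = g * nilsum c m.
Proof.
rewrite /nilsum mulrDl mulrDr mulr_algl mulr_algr; congr (_ + _).
rewrite mulr_suml mulr_sumr; apply: eq_bigr => t _; exact: gmon_central.
Qed.

Definition below m : pred nat := fun n => [exists t : 'I_m, n \in P t].

Lemma nilsum_supported c m : supported (below m) (nilsum c m).
Proof.
apply: supportedD; first by apply/supportedZ/supported1.
apply: big_ind => [||t _]; [exact: supported0|exact: supportedD|].
by apply: supported_gmon => n /E_sub nP; apply/existsP; exists t.
Qed.

Lemma bigE_sub m : {subset bigE m <= below m}.
Proof.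
elim: m => [|m IHm] n; first by rewrite /bigE big_ord0 in_fset0.
rewrite /bigE big_ord_recr /= in_fsetU => /orP[/IHm/existsP[t nP]|/E_sub nP].
  by apply/existsP; exists (widen_ord (leqnSn m) t).
by apply/existsP; exists ord_max.
Qed.

(** The coefficient of the product of all m nilpotent summands in the n-th power
    is, up to a constant, the m-th derivative of X ^ n at c: the increment by
    one more summand of square 0 is a differentiation ([exprD_sq0]). *)
Lemma mcoeff_nilsum_exp m : exists2 s : F, s != 0 & forall c n,
  (nilsum c m ^+ n)@_(bigE m) = s * ((n ^_ m)%:R * c ^+ (n - m)).
Proof.
have below_disj u n : n \in below u -> n \notin P u.
  move=> /existsP[t nP]; apply/negP => /(P_disj nP) tu.
  by have := ltn_ord t; rewrite tu ltnn.
elim: m => [|m [s nzs IHm]].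
  exists 1 => [|c n]; first exact: oner_neq0.
  rewrite /nilsum /bigE !big_ord0 addr0 exprZn expr1n mcoeffZ -gmon0 mcoeff_gmon.
  by rewrite eqxx mulr1 !mul1r subn0.
exists (gsign F (bigE m) (E m) * s).
  rewrite mulf_neq0 // gsign_neq0 //; apply/fdisjointP => n /bigE_sub nb.
  by apply: contra (below_disj _ _ nb) => /E_sub.
move=> c n.
have -> : nilsum c m.+1 = nilsum c m + gmon (E m).
  by rewrite /nilsum big_ord_recr addrA.
have -> : bigE m.+1 = bigE m `|` E m by rewrite /bigE big_ord_recr.
rewrite exprD_sq0; [|exact: nilsum_central|by rewrite gmon_sq].
rewrite mcoeffD mcoeffMn (mcoeffM_disjoint (P := below m) (Q := P m)); first last.
- by move=> k; exact: below_disj.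
- exact: E_sub.
- exact: bigE_sub.
- by apply: supported_gmon; exact: E_sub.
- by apply/supportedX/nilsum_supported.
have [k kE] : exists k, k \in E m by apply/fset0Pn.
rewrite (mcoeff_supported (P := below m) (n := k)) ?add0r; first last.
- by apply: contraL (E_sub kE) => /below_disj.
- by rewrite in_fsetU kE orbT.
- by apply/supportedX/nilsum_supported.
rewrite IHm mcoeff_gmon eqxx mulr1.
case: n => [|n].
  by rewrite [(0 ^_ m.+1)%N]ffact0n /= mulr0n mul0r mulr0.
by rewrite ffactSS natrM subSS /= -!mulrA (mulr_natl _ n.+1) !mulrnAr.
Qed.
End GenericNilpotent.
End DisjointSupports.

(** * Independence of the normal forms *)

(** The u i being central, the factors x i can be brought next to W one after
    the other. *)
Lemma prod_exp_absorb (R : nzRingType) (V : Type) (s : seq V) (x u : V -> R)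
    (n : V -> nat) (W : R) :
    (forall i r, u i * r = r * u i) -> (forall i, x i * W = u i * W) ->
  (\prod_(i <- s) x i ^+ n i) * W = (\prod_(i <- s) u i ^+ n i) * W.
Proof.
move=> uC xW; have uXC i k r : u i ^+ k * r = r * u i ^+ k.
  by apply: commr_sym; apply: commrX; exact/commr_sym/uC.
have xXW i k : x i ^+ k * W = u i ^+ k * W.
  elim: k => [|k IHk]; first by rewrite !expr0.
  by rewrite exprSr -mulrA xW uC mulrA IHk -mulrA -uC mulrA -exprSr.
elim: s => [|i s IHs]; first by rewrite !big_nil.
rewrite !big_cons -!mulrA IHs.
have prodC r : (\prod_(j <- s) u j ^+ n j) * r = r * \prod_(j <- s) u j ^+ n j.
  elim: s {IHs} => [|j s IH]; first by rewrite big_nil mulr1 mul1r.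
  by rewrite big_cons -mulrA IH mulrA uXC mulrA.
by rewrite prodC mulrA xXW -mulrA -prodC.
Qed.

Section Independence.
Context {F : finFieldType} (p : nat).
Context (charFp : p \in [pchar F]) (p_gt2 : (2 < p)%N).
Context {V : finType} (v : V -> gvar) (v_inj : injective v).
Local Notation gmon := (gmon F).

Let two_neq0 : 2%:R != 0 :> F := pchar_two_neq0 charFp p_gt2.

Lemma commprod_anticomm (a : V -> grassmann F) l :
    (forall i, gpure true (a i)) -> ~~ odd (size l) ->
  commprod a l = 2%:R ^+ (size l)./2 *: \prod_(i <- l) a i.
Proof.
move=> ap; move: l; fix IH 1 => -[|i [|j l]] //=.
  by move=> _; rewrite big_nil expr0 scale1r.
rewrite negbK => odd_l; rewrite IH // !big_cons exprS.
have -> : commutator (a i) (a j) = 2%:R *: (a i * a j).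
  rewrite /commutator [X in _ - X](gpureC (ap j) (ap i)) expr1 scaleN1r opprK.
  by rewrite -mulr2n scaler_nat.
by rewrite scalerMM mulrA.
Qed.

(** The scalars that may be added to a nilpotent value of the variable: an
    element of odd degree has no constant term. *)
Definition eval_points (i : V) : seq F := if gvar_deg (v i) then [:: 0] else enum F.

(** The position of the n-th generator reserved for the variable i. Its parity
    is b, hence the generator is even for the grading when b is true. *)
Definition gen_index (b : bool) (i : V) (n : nat) : nat := (choice.pickle (i, n)).*2 + b.

Lemma odd_gen_index b i n : odd (gen_index b i n) = b.
Proof. by rewrite /gen_index oddD odd_double; case: b. Qed.

Lemma gen_index_inj b b' i j n m :
  gen_index b i n = gen_index b' j m -> (i, n) = (j, m).
Proof.
move=> eq_ij; apply: (pcan_inj choice.pickleK).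
rewrite -(half_bit_double (choice.pickle (i, n)) b).
rewrite -(half_bit_double (choice.pickle (j, m)) b').
by rewrite ![(nat_of_bool _ + _)%N]addnC -/(gen_index b i n) eq_ij.
Qed.

Let z i := gvar_deg (v i).
(** A block is a product of two generators, central as its length is even, and
    of the same degree as the variable. *)
Definition even_block i t : {fset nat} :=
  [fset gen_index (~~ z i) i t.*2; gen_index true i t.*2.+1].
(** Blocks with t < p use the numbers below 2 p, so 2 p is free for the extra
    generator. *)
Definition odd_gen i : nat := gen_index (~~ z i) i p.*2.

Lemma even_block_mem i t n :
  n \in even_block i t -> exists b m, n = gen_index b i m /\ m./2 = t.
Proof.
rewrite in_fset2 => /orP[/eqP->|/eqP->].
  by exists (~~ z i), t.*2; rewrite doubleK.
by exists true, t.*2.+1; rewrite /= uphalf_double.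
Qed.

Lemma even_block_gen_neq i t : gen_index (~~ z i) i t.*2 != gen_index true i t.*2.+1.
Proof. by apply/eqP => /gen_index_inj[] /eqP; rewrite eqn_leq ltnn andbF. Qed.

Lemma zdeg_even_block i t : zdeg (even_block i t) = z i.
Proof.
rewrite zdegU; last by rewrite fdisjoint1X in_fset1 even_block_gen_neq.
by rewrite !zdeg1 !odd_gen_index negbK addn0.
Qed.

Lemma odd_even_block i t : ~~ odd #|` even_block i t|.
Proof. by rewrite cardfs2 even_block_gen_neq. Qed.

Lemma even_block_neq0 i t : even_block i t != fset0.
Proof. by apply/fset0Pn; exists (gen_index true i t.*2.+1); rewrite in_fset2 eqxx orbT. Qed.

Let P i t : pred nat := fun n => n \in even_block i t.
Let Pi i : pred nat := below (P i) p.

Lemma P_disj i t j u n : n \in P i t -> n \in P j u -> (i, t) = (j, u).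
Proof.
move=> /even_block_mem[b [m [-> <-]]] /even_block_mem[b' [m' [/gen_index_inj[-> ->] <-]]].
by [].
Qed.

Lemma Pi_disj i j n : n \in Pi i -> n \in Pi j -> i = j.
Proof. by move=> /existsP[t nt] /existsP[u /(P_disj nt)[]]. Qed.

Lemma odd_gen_inj : injective odd_gen.
Proof. by move=> i j /gen_index_inj[]. Qed.

Lemma odd_gen_notin i j : odd_gen j \notin Pi i.
Proof.
apply/existsP => -[t /even_block_mem[b [m [/gen_index_inj[_ <-]]]]].
by rewrite doubleK => pt; have := ltn_ord t; rewrite -pt ltnn.
Qed.

Lemma phi_infty_eigenD b g h : phi_infty F g = (-1) ^+ b *: g ->
  phi_infty F h = (-1) ^+ b *: h -> phi_infty F (g + h) = (-1) ^+ b *: (g + h).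
Proof.
move=> gE hE; have -> : phi_infty F (g + h) = phi_infty F g + phi_infty F h by exact: raddfD.
by rewrite gE hE scalerDr.
Qed.

(** The substitution at scalars c, with m i blocks for the variable i and the
    extra generator for the variables in S. *)
Section Point.
Context (c : V -> F) (m : V -> nat) (S : {set V}).
Hypothesis c_point : forall i, c i \in eval_points i.
Hypothesis m_lt : forall i, (m i < p)%N.

Let u i : grassmann F := nilsum (even_block i) (c i) (m i).
Let a i : grassmann F := if i \in S then gmon [fset odd_gen i] else 0.

Definition point (x : gvar) : grassmann F :=
  if [pick i | v i == x] is Some i then u i + a i else 0.

Lemma point_var i : point (v i) = u i + a i.
Proof.
rewrite /point; case: (pickP (fun j => v j == v i)) => [j /eqP /v_inj -> //|].
by move/(_ i); rewrite eqxx.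
Qed.

Lemma point_gcomponent x : gcomponent (gvar_deg x) (point x).
Proof.
apply/(gcomponentP charFp p_gt2); rewrite /point.
case: (pickP (fun j => v j == x)) => [i /eqP <-|_]; last by rewrite raddf0 scaler0.
have phi0 b : phi_infty F 0 = (-1) ^+ b *: 0 by rewrite raddf0 scaler0.
apply: phi_infty_eigenD; last first.
  rewrite /a; case: ifP => _; last exact: phi0.
  by rewrite phi_infty_gmon zdeg1 odd_gen_index negbK.
apply: phi_infty_eigenD.
  have := c_point i; rewrite /eval_points; case: gvar_deg => [|_].
    by rewrite inE => /eqP ->; rewrite scale0r.
  by rewrite expr0 scale1r -[X in phi_infty F X]/(in_alg _ _) rmorph_alg.
apply: (big_ind (fun g => phi_infty F g = (-1) ^+ z i *: g)) => [|g h|t _].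
- exact: phi0.
- exact: phi_infty_eigenD.
by rewrite phi_infty_gmon zdeg_even_block.
Qed.

Let uC i g : u i * g = g * u i.
Proof. exact/nilsum_central/odd_even_block. Qed.

Let a_pure i : gpure true (a i).
Proof.
rewrite /a; case: ifP => _ T; last by rewrite msupp0.
by rewrite gmon.unlock msuppU oner_eq0 in_fset1 => /eqP ->; rewrite cardfs1.
Qed.

Let O : {fset nat} := \big[@fsetU _/fset0]_(i <- enum S) [fset odd_gen i].

Lemma commprod_point (T : {set V}) : ~~ odd #|T| -> ~~ (T \subset S) ->
  commprod (fun i => u i + a i) (enum T) = 0.
Proof.
move=> evenT /subsetPn[i iT iS]; rewrite commprod_central // commprod_anticomm -?cardE //.
have: i \in enum T by rewrite mem_enum.
have ai : a i = 0 by rewrite /a (negPf iS).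
by case/splitPr => l1 l2; rewrite big_cat /= big_cons ai mul0r mulr0 scaler0.
Qed.

Lemma commprod_point_self : ~~ odd #|S| ->
  exists2 w : F, w != 0 & commprod (fun i => u i + a i) (enum S) = w *: gmon O.
Proof.
move=> evenS; rewrite commprod_central // commprod_anticomm -?cardE //.
have disjO i j n : n \in pred1 (odd_gen i) -> n \in pred1 (odd_gen j) -> i = j.
  by rewrite !inE => /eqP -> /eqP /odd_gen_inj.
have subO i : {subset [fset odd_gen i] <= pred1 (odd_gen i)}.
  by move=> n; rewrite in_fset1.
have [e nze prodE] := @prod_gmon_disjoint F V (fun i => pred1 (odd_gen i))
  (fun i => [fset odd_gen i]) disjO subO (enum S) (enum_uniq S).
exists (2%:R ^+ #|S|./2 * e); first by rewrite mulf_neq0 // expf_neq0.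
rewrite -scalerA -prodE; congr (_ *: _); apply: eq_big_seq => i.
by rewrite mem_enum /a => ->.
Qed.

Let mem_O n : (n \in O) = has (fun i => n == odd_gen i) (enum S).
Proof. by rewrite /O mem_bigA; apply: eq_has => i; rewrite in_fset1. Qed.

Let PiS : pred nat := fun n => has (fun i => n \in Pi i) (index_enum V).

Let PiS_notin_O n : n \in PiS -> n \notin O.
Proof.
move=> /hasP[i _ nPi]; rewrite mem_O; apply/hasPn => j _; apply: contraL nPi.
by move=> /eqP ->; exact: odd_gen_notin.
Qed.

Let below_Pi i : {subset below (P i) (m i) <= Pi i}.
Proof.
by move=> n /existsP[t nt]; apply/existsP; exists (widen_ord (ltnW (m_lt i)) t).
Qed.

Let supported_u i n : supported (Pi i) (u i ^+ n).
Proof.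
by apply/supportedX/(supportedS (@below_Pi i))/nilsum_supported => t k.
Qed.

(** The coefficient of the monomial formed by all the blocks and extra
    generators. The product of the extra generators absorbs the extra summand
    of each factor, as each generator squares to 0. *)
Lemma mcoeff_point : exists2 w : F, w != 0 & forall al : V -> nat,
  ((\prod_i (u i + a i) ^+ al i) * gmon O)@_
    ((\big[@fsetU _/fset0]_(i <- index_enum V) bigE (even_block i) (m i)) `|` O)
  = w * \prod_i ((al i ^_ m i)%:R * c i ^+ (al i - m i)).
Proof.
set B := \big[_/_]_(i <- _) _.
have disj i t j n : n \in P i t -> n \in P i j -> t = j.
  by move=> nt /(P_disj nt)[].
have ex_w i : exists w : F, w != 0 /\ forall n,
    (u i ^+ n)@_(bigE (even_block i) (m i)) = w * ((n ^_ m i)%:R * c i ^+ (n - m i)).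
  have [s nzs sP] := @mcoeff_nilsum_exp F (even_block i) (P i) (odd_even_block i)
    (even_block_neq0 i) (fun t n nE => nE) (disj i) (m i).
  by exists s; split=> // n; exact: sP.
have [w wP] := fin_all_exists ex_w.
have sub_Pi i : {subset bigE (even_block i) (m i) <= Pi i}.
  by move=> n nE; apply: below_Pi; apply: (bigE_sub _ nE) => t k.
have [e nze eP] := @mcoeff_prod_disjoint F V Pi (fun i => bigE (even_block i) (m i))
  Pi_disj sub_Pi (index_enum V) (index_enum_uniq V).
have B_sub : {subset B <= PiS}.
  move=> n; rewrite mem_bigA => /hasP[i iV nE]; apply/hasP; exists i => //.
  exact: sub_Pi.
exists (gsign F B O * (e * \prod_i w i)).
  rewrite !mulf_neq0 //; last by apply/prodf_neq0 => i _; case: (wP i).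
  by apply/gsign_neq0/fdisjointP => n /B_sub; exact: PiS_notin_O.
have absorb i : (u i + a i) * gmon O = u i * gmon O.
  rewrite mulrDl /a; case: ifP => iS; last by rewrite mul0r addr0.
  rewrite gmonM /gsign fdisjoint1X mem_O ifF ?scale0r ?addr0 //.
  by apply/negbTE; rewrite negbK; apply/hasP; exists i; rewrite ?mem_enum.
move=> al; rewrite (prod_exp_absorb _ _ uC absorb).
rewrite (@mcoeffM_disjoint F PiS (fun n => n \in O)) //; last first.
- exact: supported_gmon.
- apply: supported_prod => i.
  apply: (@supportedS F (Pi i) PiS _ _ (@supported_u i _)) => n nPi.
  by apply/hasP; exists i; rewrite ?mem_index_enum.
rewrite (eP (fun i => u i ^+ al i)) // mcoeff_gmon eqxx mulr1 -!mulrA.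
congr (_ * (_ * _)); rewrite -big_split; apply: eq_bigr => i _ /=.
by case: (wP i).
Qed.

End Point.

(** By induction on the size of S: at the points attached to S the terms of
    smaller sets vanish by induction and those of other sets because one of
    their commutators has a central entry. *)
Lemma normal_form_independent D (k : {ffun V -> 'I_D} -> {set V} -> F) :
    (forall al S, k al S != 0 -> valid (fun i => p * size (eval_points i))%N al S) ->
    (forall s, (forall x, gcomponent (gvar_deg x) (s x)) ->
       \sum_al \sum_S k al S *: normal_form (fun i => s (v i)) al S = 0 :> grassmann F) ->
  forall S al, k al S = 0.
Proof.
move=> kv k0 S; have [n] := ubnP #|S|; elim: n S => // n IHn S; rewrite ltnS => leS.
have [oddS|evenS] := boolP (odd #|S|).
  by move=> al; apply/eqP; apply: contraTT oddS => /kv[_ ->].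
pose Q := (F * nat)%type.
pose wQ i (q : Q) := q.1 \in eval_points i /\ (q.2 < p)%N.
have p_gt0 : (0 < p)%N by apply: ltn_trans p_gt2.
have q0 i : wQ i (0, 0%N).
  by split=> //; rewrite /eval_points; case: ifP => _; rewrite ?inE ?mem_enum.
(* Separate the coefficients by their values at all pairs of a scalar and an
   order of derivation. *)
apply: (@tensor_independence F V _ Q (fun i (b : 'I_D) => (b < p * size (eval_points i))%N)
  wQ (fun i q (b : 'I_D) => (b ^_ q.2)%:R * q.1 ^+ (b - q.2)) _ q0).
- move=> i l l_small l0; apply: (poly_taylor_independence charFp _ l_small).
    by rewrite /eval_points; case: ifP => // _; exact: enum_uniq.
  by move=> c m cr mp; exact: (l0 (c, m) (conj cr mp)).
- by move=> al /kv[].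
move=> Qs QsP.
pose c i := (Qs i).1; pose m i := (Qs i).2.
have c_point i : c i \in eval_points i by case: (QsP i).
have m_lt i : (m i < p)%N by case: (QsP i).
pose x i := nilsum (even_block i) (c i) (m i)
  + (if i \in S then gmon [fset odd_gen i] else 0).
have pointE : (fun i => point c m S (v i)) = x.
  by apply: boolp.funext => i; exact: point_var.
have other al T : T != S -> k al T *: normal_form x al T = 0.
  move=> neqTS; have [oddT|evenT] := boolP (odd #|T|).
    have [->|/kv[_]] := eqVneq (k al T) 0; first by rewrite scale0r.
    by rewrite oddT.
  have [sTS|nsTS] := boolP (T \subset S).
    rewrite IHn ?scale0r //; apply: leq_trans leS.
    by apply: proper_card; rewrite finset.properEneq neqTS.
  by rewrite /normal_form commprod_point // mulr0 scaler0.
have sum0 : \sum_al k al S *: normal_form x al S = 0 :> grassmann F.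
  rewrite -[RHS](k0 _ (point_gcomponent m S c_point)) pointE.
  apply: eq_bigr => al _; rewrite (bigD1 S) //= big1 ?addr0 // => T; exact: other.
have [w nzw wE] := commprod_point_self c m evenS.
have [e nze eE] := mcoeff_point c S m_lt.
apply: (mulfI (mulf_neq0 nzw nze)); rewrite mulr0 mulr_sumr.
set X := (_ `|` _)%fset in eE.
rewrite -[RHS](mcoeff0 X) -sum0 [RHS](raddf_sum (mcoeff X)) /=.
apply: eq_bigr => al _.
rewrite /normal_form wE -scalerAr scalerA mcoeffZ (eE (fun i => al i)) -mulrA.
by rewrite [k al S * w]mulrC -!mulrA; congr (_ * _); rewrite mulrCA.
Qed.

End Independence.

(** * The theorem *)

Lemma feval_normal_form (F : fieldType) (V : finType) (v : V -> gvar) D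
    (A : algType F) (s : gvar -> A) (al : {ffun V -> 'I_D}) S :
  feval s (normal_form (fun i => fvar F (v i)) al S)
  = normal_form (fun i => s (v i)) al S.
Proof.
rewrite /normal_form rmorphM (commprod_morph (feval s)) rmorph_prod.
have -> : (fun i => feval s (fvar F (v i))) = (fun i => s (v i)).
  by apply: boolp.funext => i; exact: feval_var.
by congr (_ * _); apply: eq_bigr => i _; rewrite rmorphXn /= feval_var.
Qed.

Lemma seq_sub_map (T : eqType) (vs s : seq T) :
  {subset s <= vs} -> exists w : seq (seq_sub vs), map val w = s.
Proof.
elim: s => [|x s IHs] sub; first by exists [::].
have [|w wE] := IHs; first by move=> y ys; apply: sub; rewrite inE ys orbT.
by exists (SeqSub (sub x (mem_head x s)) :: w); rewrite /= wE.
Qed.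

Local Open Scope classical_set_scope.

Theorem theorem3p5 (F : finFieldType) (p : nat)
    (charFp : p \in [pchar F]) (p_gt2 : (2 < p)%N) :
  T2 (even_component (phi_infty F)) (odd_component (phi_infty F))
  = I2 F p #|F|.
Proof.
apply/seteqP; split=> [f T2f|]; last exact: I2_sub_T2G.
pose vs := flatten [seq fmonom_val m | m <- msupp f].
pose v (i : seq_sub vs) : gvar := val i.
pose x i := fvar F (v i).
pose d i := (p * size (eval_points (F := F) v i))%N.
have q_gt1 : (1 < #|F|)%N := finNzRing_gt1 F.
have p_gt0 : (0 < p)%N by apply: ltn_trans p_gt2.
have d_le i : (d i <= p * #|F|)%N.
  rewrite leq_mul2l /eval_points; case: ifP => _; first by rewrite ltnW ?orbT.
  by rewrite -cardE leqnn orbT.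
have pow i : I2 F p #|F| (x i ^+ d i) \/
    exists2 k, (k < d i)%N & I2 F p #|F| (x i ^+ d i - x i ^+ k).
  rewrite /d /eval_points /x; case: (v i) => j /=.
    right; exists p; rewrite -cardE ?ltn_Pmulr //; exact: I2_ypow.
  by left; rewrite muln1; exact: I2_zpow.
have span_lin t g h := @spanned_lin F {freealg F} _ x (I2 F p #|F|) d (p * #|F|)
  (@I2D F p #|F|) (@I2Ml F p #|F|) t g h.
have span0 := @spanned_ideal F {freealg F} _ x _ d (p * #|F|) 0 (@I2_0 F p #|F|).
have [k kv If] : spanned x (I2 F p #|F|) d (p * #|F|) f.
  rewrite [f]freealgE big_seq; apply: (big_ind (spanned x (I2 F p #|F|) d (p * #|F|))).
  - exact: span0.
  - move=> g h gs hs; rewrite -[g]scale1r; exact: span_lin.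
  move=> m fm; rewrite -[_ *: _]addr0.
  apply: span_lin; last exact: span0.
  have [|w wE] := @seq_sub_map _ vs (fmonom_val m).
    by move=> y ym; apply/flattenP; exists (fmonom_val m) => //; exact: map_f.
  rewrite -wE big_map -[X in spanned _ _ _ _ X]mulr1.
  apply: (@spanned_mon F {freealg F} _ x _ d _ _ _ _ _ _ _ pow d_le w [::]).
  - exact: I2_0.
  - exact: I2D.
  - exact: I2Ml.
  - exact: I2Mr.
  - by move=> i j l; exact: I2_comm3.
  - by move=> i j l n; exact: I2_comm2_swap.
have k0 : forall S al, k al S = 0.
  apply: (normal_form_independent charFp p_gt2 val_inj kv) => s sP.
  set g := (X in _ - X) in If.
  have /T2GP /(_ s sP) : T2 (even_component (phi_infty F)) (odd_component (phi_infty F)) g.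
    have [_ TD _ _ _] := T2G_T2_ideal charFp p_gt2.
    have gE (Z : zmodType) (a b : Z) : b = a + - (a - b) by rewrite subKr.
    rewrite (gE _ f g); apply: (TD _ _ T2f).
    exact: (I2_sub_T2G charFp p_gt2 (I2N If)).
  rewrite /g raddf_sum => sg0; rewrite -[RHS]sg0; apply: eq_bigr => al _.
  rewrite [RHS]raddf_sum; apply: eq_bigr => S _ /=.
  by rewrite linearZ /= feval_normal_form.
move: If; rewrite big1 ?subr0 // => al _; rewrite big1 // => S _.
by rewrite k0 scale0r.
Qed.
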